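(* Let $n,m\ge 2$ with $n+m\ge 5$, and let $w=(\varepsilon^{(m)},1^{(n)})\in\mathbb{Q}^{m+n}\cap(0,1]^{m+n}$ be the weight vector with $m$ entries equal to $\varepsilon$ followed by $n$ entries equal to $1$, where $\varepsilon\le 1/m$ (and $\varepsilon$ is a positive rational). Then $$\operatorname{Aut}(\Delta_{0,w})\cong\operatorname{Aut}(K_w)\cong S_m\times S_n .$$
   Context: Let $N=m+n$. For $S\subseteq\{1,\dots,N\}$ put $w(S)=\sum_{i\in S}w_i$. $K_w$ is the abstract simplicial complex with vertex set $\{1,\dots,N\}$ in which $S$ is a face iff $w(S)\le1$; $\operatorname{Aut}(K_w)\le S_N$ is the group of permutations $\sigma$ with $S\in K_w\iff\sigma(S)\in K_w$. A $w$-stable graph of genus $0$ is a pair $\mathbf{G}=(T,\mu)$ with $T$ a finite tree and $\mu:\{1,\dots,N\}\to V(T)$ a function such that $\operatorname{val}(v)-2+w(\mu^{-1}(v))>0$ for all vertices $v$. Isomorphisms are tree isomorphisms compatible with $\mu$. Contracting an edge merges its endpoints and unites their markings; contractions of $w$-stable graphs are $w$-stable. For $p\ge0$ let $[p]=\{0,\dots,p\}$. An edge-labelled graph is a pair $(\mathbf{G},\tau)$ with $\tau:E(\mathbf{G})\to[p]$ a bijection; isomorphisms of pairs must respect labels; $[\mathbf{G},\tau]$ denotes the isomorphism class. Let $\mathrm{I}$ be the category with objects $[p]$, $p\ge 0$, and morphisms all injections. A symmetric $\Delta$-complex is a functor $\mathrm{I}^{\mathrm{op}}\to\mathsf{Set}$;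 morphisms are natural transformations. $\Delta_{0,w}$ is the symmetric $\Delta$-complex with $\Delta_{0,w}[p]$ the set of classes $[\mathbf{G},\tau]$ of edge-labelled $w$-stable graphs of genus $0$ with $p+1$ edges; for an injection $\iota:[p]\to[q]$, $\iota^*[\mathbf{G},\tau]$ is obtained by contracting all edges whose label is not in the image of $\iota$ and labelling each remaining edge $e$ by $\iota^{-1}(\tau(e))$. $\operatorname{Aut}(\Delta_{0,w})$ is its group of natural automorphisms. *)

(* Defs.v *)
From HB Require Import structures.
From mathcomp Require Import all_boot all_order all_algebra all_fingroup.
From mathcomp Require Import all_solvable.
From mathcomp Require Import boolp.

Set Implicit Arguments.
Unset Strict Implicit.
Unset Printing Implicit Defensive.

Import Order.TTheory GRing.Theory Num.Theory.

Definition group_iso (G H : groupType) : Prop :=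
  exists2 f : G -> H, bijective f & {morph f : x y / (x * y)%g}.

(* The object [p] = {0, ..., p} of I is represented by the number p. *)
Definition inj p q := {f : {ffun 'I_p.+1 -> 'I_q.+1} | injectiveb f}.

Definition inj_fun p q (f : inj p q) : 'I_p.+1 -> 'I_q.+1 := val f.
Coercion inj_fun : inj >-> Funclass.

Lemma inj_funP p q (f : inj p q) : injective f.
Proof. exact/injectiveP/(valP f). Qed.

Fact inj_id_subproof p : injectiveb [ffun i : 'I_p.+1 => i].
Proof. by apply/injectiveP => x y; rewrite !ffunE. Qed.
Definition inj_id p : inj p p := exist (fun f : {ffun _ -> _} => injectiveb f) _ (inj_id_subproof p).

Fact inj_comp_subproof p q r (g : inj q r) (f : inj p q) :
  injectiveb [ffun i => g (f i)].
Proof.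
by apply/injectiveP => x y; rewrite !ffunE => /inj_funP/inj_funP.
Qed.
Definition inj_comp p q r (g : inj q r) (f : inj p q) : inj p r :=
  exist (fun f : {ffun _ -> _} => injectiveb f) _ (inj_comp_subproof g f).

Lemma inj_idE p i : inj_id p i = i.
Proof. by rewrite /inj_fun /= ffunE. Qed.
Lemma inj_compE p q r (g : inj q r) (f : inj p q) i :
  inj_comp g f i = g (f i).
Proof. by rewrite {1}/inj_fun /= ffunE. Qed.

Record symDelta := SymDelta {
  simp :> nat -> Type;
  pull : forall p q, inj p q -> simp q -> simp p;
  pull_id : forall p (x : simp p), pull (inj_id p) x = x;
  pull_comp : forall p q r (g : inj q r) (f : inj p q) (x : simp r),
    pull (inj_comp g f) x = pull f (pull g x) }.

Record sd_hom (X Y : symDelta) := SDHom {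
  hom_fun :> forall p, X p -> Y p;
  hom_nat : forall p q (f : inj p q) (x : X q),
    hom_fun (pull f x) = pull f (hom_fun x) }.

Lemma sd_hom_eq X Y (a b : sd_hom X Y) : (forall p x, a p x = b p x) -> a = b.
Proof.
case: a b => [a Ha] [b Hb] /= ab.
have {}ab : a = b.
  by apply: functional_extensionality_dep => p; apply: funext => x; apply: ab.
by rewrite -ab in Hb *; congr SDHom; apply: Prop_irrelevance.
Qed.

Definition hom_id X : sd_hom X X :=
  @SDHom X X (fun _ x => x) (fun _ _ _ _ => erefl).

Fact hom_comp_subproof X Y Z (b : sd_hom Y Z) (a : sd_hom X Y) p q
  (f : inj p q) (x : X q) : b p (a p (pull f x)) = pull f (b q (a q x)).
Proof. by rewrite !hom_nat. Qed.
Definition hom_comp X Y Z (b : sd_hom Y Z) (a : sd_hom X Y) : sd_hom X Z :=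
  SDHom (hom_comp_subproof b a).

Record sd_aut (X : symDelta) := SDAut {
  aut_hom :> sd_hom X X;
  aut_inv : sd_hom X X;
  aut_invK : hom_comp aut_inv aut_hom = hom_id X;
  aut_homK : hom_comp aut_hom aut_inv = hom_id X }.

Section AutGroup.
Variable X : symDelta.
Implicit Types a b c : sd_aut X.

Let invK a p x : aut_inv a p (a p x) = x.
Proof. by have := congr1 (fun h : sd_hom X X => h p x) (aut_invK a). Qed.
Let homK a p x : a p (aut_inv a p x) = x.
Proof. by have := congr1 (fun h : sd_hom X X => h p x) (aut_homK a). Qed.

Lemma sd_aut_eq a b : (forall p x, a p x = b p x) -> a = b.
Proof.
move=> ab; have ab1 : aut_hom a = aut_hom b by apply: sd_hom_eq.
have ab2 : aut_inv a = aut_inv b.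
  by apply: sd_hom_eq => p x; rewrite -{1}(homK b x) -ab invK.
case: a b ab1 ab2 {ab} => [a a' a1 a2] [b b' b1 b2] /= ab ab'.
by subst b b'; congr SDAut; apply: Prop_irrelevance.
Qed.

Fact aut_mul_invK a b :
  hom_comp (hom_comp (aut_inv b) (aut_inv a)) (hom_comp a b) = hom_id X.
Proof. by apply: sd_hom_eq => p x /=; rewrite !invK. Qed.
Fact aut_mul_homK a b :
  hom_comp (hom_comp a b) (hom_comp (aut_inv b) (aut_inv a)) = hom_id X.
Proof. by apply: sd_hom_eq => p x /=; rewrite !homK. Qed.

Definition aut_mul a b : sd_aut X := SDAut (aut_mul_invK a b) (aut_mul_homK a b).
Fact aut_one_subproof : hom_comp (hom_id X) (hom_id X) = hom_id X.
Proof. exact: sd_hom_eq. Qed.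
Definition aut_one : sd_aut X := SDAut aut_one_subproof aut_one_subproof.
Definition aut_V a : sd_aut X := SDAut (aut_homK a) (aut_invK a).

Fact aut_mulA : associative aut_mul.
Proof. by move=> a b c; apply: sd_aut_eq. Qed.
Fact aut_mul1 : left_id aut_one aut_mul.
Proof. by move=> a; apply: sd_aut_eq. Qed.
Fact aut_mulr1 : right_id aut_one aut_mul.
Proof. by move=> a; apply: sd_aut_eq. Qed.
Fact aut_mulV : left_inverse aut_one aut_V aut_mul.
Proof. by move=> a; apply: sd_aut_eq => p x /=; rewrite invK. Qed.
Fact aut_mulrV : right_inverse aut_one aut_V aut_mul.
Proof. by move=> a; apply: sd_aut_eq => p x /=; rewrite homK. Qed.

HB.instance Definition _ := gen_eqMixin (sd_aut X).
HB.instance Definition _ := gen_choiceMixin (sd_aut X).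
HB.instance Definition _ := isGroup.Build (sd_aut X)
  aut_mulA aut_mul1 aut_mulr1 aut_mulV aut_mulrV.
End AutGroup.

Definition weight N (w : 'I_N -> rat) (S : {set 'I_N}) : rat :=
  (\sum_(i in S) w i)%R.

Definition Kw N (w : 'I_N -> rat) : {set {set 'I_N}} :=
  [set S | (weight w S <= 1)%R].

Definition AutK N (K : {set {set 'I_N}}) : {set 'S_N} :=
  [set s : 'S_N | [forall S : {set 'I_N}, (S \in K) == (s @: S \in K)]].

Fact AutK_group_set N (K : {set {set 'I_N}}) : group_set (AutK K).
Proof.
apply/group_setP; split.
  rewrite inE; apply/forallP => S; apply/eqP; congr (_ \in K).
  by rewrite -[LHS]imset_id; apply: eq_imset => x; rewrite perm1.
move=> s t; rewrite !inE => /forallP sK /forallP tK; apply/forallP => S.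
rewrite (eqP (sK S)) (eqP (tK _)) -imset_comp.
by apply/eqP; congr (_ \in K); apply: eq_imset => x; rewrite permM.
Qed.
Canonical AutK_group N (K : {set {set 'I_N}}) := Group (AutK_group_set K).

Definition eps_one_weight m n (eps : rat) : 'I_(m + n) -> rat :=
  fun i => if (i < m)%N then eps else 1%R.

(* ucycle also accepts [:: x; y] for an edge xy, which is not a cycle of the
   graph; hence the bound on the size. *)
Definition is_tree (V : finType) (e : rel V) : Prop :=
  [/\ (0 < #|V|)%N, symmetric e, irreflexive e,
      forall x y, connect e x y
    & forall c, (2 < size c)%N -> ~ ucycle e c].

Definition edge_set (V : finType) (e : rel V) : {set {set V}} :=
  [set A | [exists x, exists y, e x y && (A == [set x; y])]].

Section Forests.
Variable V : finType.
Implicit Types e d : rel V.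

Let acyclic e := forall c, (2 < size c)%N -> ~ ucycle e c.

Definition del_edge e (x y : V) : rel V :=
  [rel u v | e u v && ([set u; v] != [set x; y])].

Lemma acyclic_bridge e x y : symmetric e -> irreflexive e -> acyclic e ->
  e x y -> ~~ connect (del_edge e x y) x y.
Proof.
move=> esym eirr eac exy; apply/negP => /connectP[p0 p0P yE].
move: p0P yE => /shortenP[p pP pU _] yE {p0}.
have eP : path e x p by apply: sub_path pP => u v /andP[].
apply: (eac (x :: p)); last first.
  by rewrite /ucycle /ucycleb pU andbT /= rcons_path eP -yE esym exy.
case: p pP {pU eP} yE => [_ /= yE|z [|t p] //= /andP[/andP[_ /negP xz] _] yE].
  by rewrite yE eirr in exy.
by case: xz; rewrite -yE.
Qed.

Lemma bridge_acyclic e : symmetric e ->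
  (forall x y, e x y -> ~~ connect (del_edge e x y) x y) -> acyclic e.
Proof.
move=> esym br [|x [|y [|z s]]] // _ /andP[/= /and3P[exy eyz epath]].
case/and4P; rewrite !inE !negb_or => /and3P[xy xz xs] /andP[yz ys] zs sU.
have := br _ _ exy; apply/negP; rewrite negbK.
have ds u v : e u v -> x != u -> x != v -> del_edge e x y u v.
  move=> euv xu xv; rewrite /del_edge /= euv; apply/eqP => /setP/(_ x).
  by rewrite !inE (negPf xu) (negPf xv) eqxx.
have dsym : connect_sym (del_edge e x y).
  by apply: sym_connect_sym => u v; rewrite /del_edge /= esym setUC.
rewrite dsym; apply: (@connect_trans _ _ (last z s)).
  apply/connectP; exists (z :: s) => //=; rewrite ds //=.
  have : all (fun u => x != u) (z :: s).
    by rewrite /= xz; apply/allP => u us; apply: contraNneq xs => ->.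
  move: epath; rewrite rcons_path => /andP[].
  elim: s (z) {eyz xz xs yz ys zs sU} => //= t s IH z0 /andP[e0 ep] el.
  by case/and3P=> h1 h2 h3; rewrite ds //= IH //= h2.
apply: connect1; move: epath; rewrite rcons_path => /andP[_ el].
rewrite /del_edge /= el; apply/eqP => /setP/(_ y).
rewrite !inE eqxx orbT (eq_sym y x) (negPf xy) orbF => /eqP yE.
by have := mem_last z s; rewrite -yE inE (negPf yz) (negPf ys).
Qed.

Lemma forest_leaf e (B : {set V}) x0 : symmetric e -> irreflexive e ->
  acyclic e -> x0 \in B ->
  exists2 x, x \in B & (#|[set y in B | e x y]| <= 1)%N.
Proof.
move=> esym eirr eac x0B.
pose P k := `[< exists x p, [/\ path e x p, uniq (x :: p),
  {subset x :: p <= B} & size p = k] >].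
have exP : exists k, P k.
  exists 0; apply/asboolP; exists x0, [::]; split => // x.
  by rewrite inE => /eqP->.
have bdP k : P k -> (k <= #|V|)%N.
  move=> /asboolP[x [p [_ /card_uniqP /= pU _ <-]]].
  by apply: leq_trans (max_card [in x :: p]); rewrite pU.
case: (ex_maxnP exP bdP) => k /asboolP[x [p [pP pU pB pk]]] kmax.
exists x; first by apply: pB; rewrite mem_head.
apply: (@leq_trans #|[set head x p]|); last by rewrite cards1.
apply/subset_leq_card/subsetP => y; rewrite !inE => /andP[yB exy].
have [yp|yp] := boolP (y \in x :: p); last first.
  suff /kmax : P k.+1 by rewrite ltnn.
  apply/asboolP; exists y, (x :: p); split; rewrite /= ?pk //.
  - by rewrite esym exy.
  - by rewrite yp; exact: pU.
  - by move=> u; rewrite inE => /predU1P[->|/pB].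
have {yp} : y \in p.
  by move: yp; rewrite inE => /predU1P[yx|//]; rewrite yx eirr in exy.
case: p pP pU {pB pk} => //= z p /andP[exz pP] /and3P[xN zN pU].
rewrite inE => /orP[//|yp]; exfalso.
case/path.splitP: yp pP xN zN pU => p1 p2.
rewrite cat_path => /andP[pP _]; rewrite -cat_cons inE mem_cat !negb_or.
move=> /and3P[xz xp1 _]; rewrite mem_cat negb_or => /andP[zp1 _].
rewrite cat_uniq => /andP[p1U _].
apply: (eac (x :: z :: rcons p1 y)); first by rewrite /= size_rcons.
rewrite /ucycle /ucycleb /= rcons_path exz pP last_rcons esym exy /=.
by rewrite inE negb_or xz xp1 zp1 p1U.
Qed.

Lemma forest_count e (B : {set V}) : symmetric e -> irreflexive e ->
  acyclic e -> B != set0 ->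
  (\sum_(x in B) \sum_(y in B) e x y + 2 <= 2 * #|B|)%N.
Proof.
move=> esym eirr eac; have [k] := ubnP #|B|; elim: k B => // k IH B.
rewrite ltnS => Bk /set0Pn[x0 x0B].
have [x xB xl] := forest_leaf esym eirr eac x0B.
pose C := B :\ x.
have cE : #|B| = #|C|.+1 by rewrite (cardsD1 x) xB.
have sE (F : V -> nat) : (\sum_(y in B) F y = F x + \sum_(y in C) F y)%N.
  by rewrite (big_setD1 x).
have dE : (\sum_(y in C) e x y <= 1)%N.
  apply: leq_trans xl; rewrite -sum1_card big_mkcond [leqRHS]big_mkcond /=.
  apply: leq_sum => y _; rewrite !inE; case: (y == x) => //=.
  by case: (y \in B) => //=; case: (e x y).
rewrite sE /= sE eirr add0n.
have -> : (\sum_(y in C) \sum_(z in B) e y z =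
    \sum_(y in C) e x y + \sum_(y in C) \sum_(z in C) e y z)%N.
  by rewrite -big_split /=; apply: eq_bigr => y _; rewrite sE esym.
have [C0|C0] := eqVneq C set0.
  by rewrite cE C0 !big_set0 cards0.
have := IH C; rewrite -cE Bk => /(_ isT C0).
rewrite cE mulnS => h; rewrite -addnA (leq_trans _ (_ : 1 + (1 + 2 * #|C|) <= _)%N) //.
by rewrite leq_add // -addnA leq_add.
Qed.

End Forests.

Section TreeContraction.
Variables (V W : finType) (e d : rel V) (c : V -> W).
Hypothesis etree : is_tree e.
Hypothesis dsub : subrel d e.
Hypothesis dset : forall x y x' y', [set x; y] = [set x'; y'] -> d x y -> d x' y'.
Hypothesis csurj : forall u, exists x, c x = u.
Hypothesis cE : forall x y, (c x == c y) = connect d x y.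

Definition contr_adj : rel W := [rel u v | (u != v) &&
  [exists x, exists y, [&& e x y, c x == u & c y == v]]].

Let esym : symmetric e. Proof. by case: etree. Qed.
Let eirr : irreflexive e. Proof. by case: etree. Qed.
Let eac : forall s, (2 < size s)%N -> ~ ucycle e s. Proof. by case: etree. Qed.
Let dsym : symmetric d.
Proof. by move=> x y; apply/idP/idP; apply: dset; rewrite setUC. Qed.

Lemma contr_noloop x y : e x y -> c x = c y -> d x y.
Proof.
move=> exy cxy; apply: contraT => ndxy.
have := acyclic_bridge esym eirr eac exy; apply: contraTT => _; rewrite negbK.
have : connect d x y by rewrite -cE cxy.
apply: connect_sub => u v duv; apply: connect1; rewrite /del_edge /= dsub //=.
by apply: contraNneq ndxy => /dset; apply.
Qed.

Lemma contr_uniq x y x' y' : e x y -> e x' y' -> c x = c x' -> c y = c y' ->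
  c x != c y -> x = x' /\ y = y'.
Proof.
move=> exy exy' cx cy cxy; have [xyE|xyN] := eqVneq [set x'; y'] [set x; y].
  have : x \in [set x'; y'] by rewrite xyE set21.
  have : y \in [set x'; y'] by rewrite xyE set22.
  have xy : x == y = false by apply: contraNF cxy => /eqP->.
  rewrite !inE => /orP[]/eqP yE /orP[]/eqP xE; split => //.
  - by rewrite xE yE eqxx in xy.
  - by rewrite yE cx eqxx in cxy.
  - by rewrite yE cx eqxx in cxy.
  - by rewrite xE yE eqxx in xy.
case/negP: (acyclic_bridge esym eirr eac exy).
have dconn : subrel (connect d) (connect (del_edge e x y)).
  apply: connect_sub => u v duv; apply: connect1; rewrite /del_edge /= dsub //=.
  apply: contraNneq cxy => uvE; rewrite cE; apply: connect1.
  exact: dset duv.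
apply: (@connect_trans _ _ x'); first by apply: dconn; rewrite -cE cx.
apply: (@connect_trans _ _ y'); last by apply: dconn; rewrite -cE cy.
by apply: connect1; rewrite /del_edge /= exy'.
Qed.

Lemma contr_tree : is_tree contr_adj.
Proof.
have adjS : symmetric contr_adj.
  move=> u v; rewrite /contr_adj /= eq_sym; congr andb.
  apply/existsP/existsP => -[x /existsP[y /and3P[xy cx cy]]];
  by exists y; apply/existsP; exists x; rewrite esym xy cx cy.
have adjC x y : e x y -> connect contr_adj (c x) (c y).
  move=> exy; have [->//|cxy] := eqVneq (c x) (c y).
  apply: connect1; rewrite /contr_adj /= cxy; apply/existsP; exists x.
  by apply/existsP; exists y; rewrite exy !eqxx.
split => //.
- case: etree => /card_gt0P[x _] _ _ _ _.
  by apply/card_gt0P; exists (c x).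
- by move=> u; rewrite /contr_adj /= eqxx.
- move=> u v; have [x <-] := csurj u; have [y <-] := csurj v.
  case: etree => _ _ _ /(_ x y)/connectP[p pP ->] _.
  elim: p x pP => //= z p IH x /andP[exz /IH]; apply: connect_trans.
  exact: adjC.
apply: bridge_acyclic => // u v /andP[uvN] /existsP[x /existsP[y]].
case/and3P => exy /eqP cx /eqP cy; apply/negP => /connectP[p pP vE].
have := acyclic_bridge esym eirr eac exy; apply/negP; rewrite negbK.
have dconn : subrel (connect d) (connect (del_edge e x y)).
  apply: connect_sub => a b dab; apply: connect1; rewrite /del_edge /= dsub //=.
  apply: contraNneq uvN => abE; rewrite -cx -cy cE; apply: connect1.
  exact: dset dab.
have : forall z, c z = u -> connect (del_edge e x y) z y; last exact.
have {dconn} dconn a b : c a = c b -> connect (del_edge e x y) a b.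
  by move=> ab; apply: dconn; rewrite -cE ab.
move: {2 3 4}u pP vE; elim: p => [|t p IH] s /=.
  by move=> _ <- z zv; apply: dconn; rewrite zv.
move=> /andP[/andP[/andP[_ /existsP[a /existsP[b]]]]].
case/and3P => eab /eqP ca /eqP cb stN pP vE z zs.
apply: (@connect_trans _ _ a); first by apply: dconn; rewrite zs.
apply: (@connect_trans _ _ b); last exact: IH pP vE b cb.
apply: connect1; rewrite /del_edge /= eab; apply: contraNneq stN => abE.
have := congr1 (fun A : {set V} => c @: A) abE.
by rewrite !imsetU !imset_set1 ca cb cx cy => ->.
Qed.

Lemma contr_val u : (#|contr_adj u| + 2 * #|[set x | c x == u]| >=
  \sum_(x in [set x | c x == u]) #|e x| + 2)%N.
Proof.
set B := [set x | c x == u].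
have [x0 x0u] := csurj u.
have B0 : B != set0 by apply/set0Pn; exists x0; rewrite inE x0u.
have dac s : (2 < size s)%N -> ~ ucycle d s.
  move=> s2 /andP[sc sU]; apply: (eac s2); rewrite /ucycle /ucycleb sU andbT.
  exact: sub_cycle sc.
have dirr : irreflexive d.
  by move=> x; apply: contraFF (eirr x); apply: dsub.
have := forest_count dsym dirr dac B0; rewrite -/B => cnt.
pose F := [set z : V * V | [&& z.1 \in B, e z.1 z.2 & ~~ d z.1 z.2]].
have FE : (\sum_(x in B) #|e x| =
    \sum_(x in B) \sum_(y in B) d x y + #|F|)%N.
  have -> : #|F| = (\sum_(x in B) \sum_y (e x y && ~~ d x y))%N.
    rewrite -sum1_card big_mkcond /= pair_big_dep /= [RHS]big_mkcond /=.
    apply: eq_bigr => -[x y] _ /=; rewrite !inE /= andbT.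
    by case: (_ == u); case: (e x y && _).
  rewrite -big_split /=; apply: eq_bigr => x xB.
  rewrite [X in (X + _)%N]big_mkcond -big_split /= -sum1_card big_mkcond /=.
  apply: eq_bigr => y _; rewrite -[y \in e x]/(e x y).
  have [dxy|dxy] /= := boolP (d x y); last first.
    by rewrite andbT if_same add0n; case: (e x y).
  rewrite (dsub dxy) inE.
  suff -> : c y == u by [].
  by move: xB; rewrite inE => /eqP <-; rewrite eq_sym cE; apply: connect1.
have Finj : {in F &, injective (fun z : V * V => c z.2)}.
  move=> [x y] [x' y']; rewrite !inE /= => /and3P[/eqP xu exy nxy].
  move=> /and3P[/eqP xu' exy' _] cy.
  have cxy : c x != c y by apply: contraNneq nxy => /(contr_noloop exy).
  have [|-> ->] // := contr_uniq exy exy' _ cy cxy.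
  by rewrite xu xu'.
have Fle : (#|F| <= #|contr_adj u|)%N.
  rewrite -(card_in_imset Finj); apply: subset_leq_card.
  apply/subsetP => _ /imsetP[[x y] + ->]; rewrite !inE /=.
  move=> /and3P[/eqP xu exy nxy].
  rewrite -xu.
  rewrite (contraNneq _ nxy) => [/=|/(contr_noloop exy)//].
  by apply/existsP; exists x; apply/existsP; exists y; rewrite exy !eqxx.
rewrite FE addnC addnA addnC leq_add // addnC; exact: cnt.
Qed.

End TreeContraction.

Local Open Scope quotient_scope.

Section StableGraphs.
Variables (N : nat) (w : 'I_N -> rat).

(* Graphs are considered up to isomorphism only, so the vertex set is taken
   to be an initial segment of the natural numbers; this keeps the collection
   of all graphs small. *)
Record stable_graph := StableGraph {
  nvert : nat;
  adj : rel 'I_nvert;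
  adj_tree : is_tree adj;
  mark : 'I_N -> 'I_nvert;
  stableP : forall v,
    (0 < #|adj v|%:R - 2 + weight w [set i | mark i == v])%R }.

Definition vert (G : stable_graph) := 'I_(nvert G).

Definition edge (G : stable_graph) :=
  {A : {set vert G} | A \in edge_set (@adj G)}.

Record el_graph (p : nat) := ELGraph {
  el_base :> stable_graph;
  lab : edge el_base -> 'I_p.+1;
  lab_bij : bijective lab }.

Definition graph_iso (G H : stable_graph) (f : vert G -> vert H) : Prop :=
  [/\ bijective f, {mono f : x y / adj x y}
    & forall i, mark H i = f (mark G i)].

Definition el_iso p (G H : el_graph p) : Prop :=
  exists2 f : vert G -> vert H, graph_iso f &
    forall (a : edge G) (b : edge H), val b = f @: val a -> lab b = lab a.

Lemma edgeP (G : stable_graph) (A : {set vert G}) :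
  reflect (exists x y, adj x y /\ A = [set x; y]) (A \in edge_set (@adj G)).
Proof.
rewrite inE; apply: (iffP existsP) => -[x].
  by case/existsP => y /andP[xy /eqP->]; exists x, y.
by move=> [y [xy ->]]; exists x; apply/existsP; exists y; rewrite xy eqxx.
Qed.

Lemma edge_ends (G : stable_graph) (a : edge G) :
  exists x y, adj x y /\ val a = [set x; y].
Proof. exact/edgeP/(valP a). Qed.

Lemma mk_edge (G : stable_graph) (x y : vert G) :
  adj x y -> exists a : edge G, val a = [set x; y].
Proof.
move=> xy; have h : [set x; y] \in edge_set (@adj G) by apply/edgeP; exists x, y.
by exists (exist (fun A => A \in edge_set (@adj G)) _ h).
Qed.

Lemma imset_pair (aT rT : finType) (f : aT -> rT) x y :
  f @: [set x; y] = [set f x; f y].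
Proof. by rewrite imsetU !imset_set1. Qed.

Lemma el_iso_refl p (G : el_graph p) : el_iso G G.
Proof.
exists id; first by split=> //; exists id.
by move=> a b; rewrite imset_id => /val_inj->.
Qed.

Lemma el_iso_sym p (G H : el_graph p) : el_iso G H -> el_iso H G.
Proof.
case=> f [[g fK gK] fadj fmark] flab; exists g.
  split=> [|x y|i]; first by exists f.
    by rewrite -fadj !gK.
  by rewrite fmark fK.
move=> a b ba; symmetry; apply: flab.
by rewrite ba -imset_comp (eq_imset _ gK) imset_id.
Qed.

Lemma el_iso_trans p (H G K : el_graph p) :
  el_iso G H -> el_iso H K -> el_iso G K.
Proof.
case=> f [fbij fadj fmark] flab [g [gbij gadj gmark] glab]; exists (g \o f).
  split=> [|x y|i] /=; first exact: bij_comp.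
    by rewrite gadj fadj.
  by rewrite gmark fmark.
move=> a b ba; have [x [y [xy aE]]] := edge_ends a.
have [|a' a'E] := @mk_edge H (f x) (f y); first by rewrite fadj.
have fa : val a' = f @: val a by rewrite a'E aE imset_pair.
by rewrite -(flab _ _ fa); apply: glab; rewrite ba fa -imset_comp.
Qed.

Definition el_isob p : rel (el_graph p) := fun G H => `[< el_iso G H >].

Fact el_isob_equiv p : equiv_class_of (@el_isob p).
Proof.
split=> [G|G H|H G K].
- exact/asboolP/el_iso_refl.
- by apply/asboolP/asboolP => /el_iso_sym.
- by move=> /asboolP GH /asboolP HK; apply/asboolP/(el_iso_trans GH).
Qed.

HB.instance Definition _ p := gen_eqMixin (el_graph p).
HB.instance Definition _ p := gen_choiceMixin (el_graph p).

Canonical el_equiv p := EquivRelPack (el_isob_equiv p).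

Definition el_class p := {eq_quot (el_equiv p)}.

Definition dropped p q (i : inj p q) (G : el_graph q) : rel (vert G) :=
  [rel x y | [exists a : edge G,
     (val a == [set x; y]) && (lab a \notin codom i)]].
Arguments dropped [p q] i G _ _.

(* c : V(G) -> V(H) exhibits H as the result of contracting in G all edges
   whose label is not in the image of i and relabelling the other ones. *)
Record is_contraction p q (i : inj p q) (G : el_graph q) (H : el_graph p)
    (c : vert G -> vert H) : Prop := IsContraction {
  ctr_surj : forall u, exists x, c x = u;
  ctr_fiber : forall x y, (c x == c y) = connect (dropped i G) x y;
  ctr_adj : forall u v, adj u v = (u != v) &&
    [exists x, exists y, [&& adj x y, c x == u & c y == v]];
  ctr_mark : forall k, mark H k = c (mark G k);
  ctr_lab : forall (a : edge G) (b : edge H),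
    val b = c @: val a -> i (lab b) = lab a }.

Definition contracts p q (i : inj p q) (G : el_graph q) (H : el_graph p) :=
  exists c : vert G -> vert H, is_contraction i c.

Lemma quotient_map (V : finType) (d : rel V) : symmetric d ->
  exists k (c : V -> 'I_k), (forall u, exists x, c x = u) /\
    (forall x y, (c x == c y) = connect d x y).
Proof.
move=> /sym_connect_sym dsym.
pose T := {x : V | roots d x}.
pose c0 x : T := exist (fun x => roots d x) (fingraph.root d x) (roots_root dsym x).
exists #|{: T}|, (fun x => enum_rank (c0 x)); split.
  move=> u; exists (val (enum_val u)); rewrite -[RHS]enum_valK; congr enum_rank.
  by apply: val_inj => /=; apply/eqP; case: (enum_val u).
by move=> x y; rewrite (inj_eq enum_rank_inj) -val_eqE /= root_connect.
Qed.

Lemma droppedE p q (i : inj p q) (G : el_graph q) (a : edge G) x y :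
  val a = [set x; y] -> dropped i G x y = (lab a \notin codom i).
Proof.
move=> aE; apply/existsP/idP => [[b /andP[/eqP bE]]|]; last first.
  by exists a; rewrite aE eqxx.
by rewrite (_ : b = a) //; apply: val_inj; rewrite aE.
Qed.

Lemma pair_eq (T : finType) (x y u v : T) : [set x; y] = [set u; v] ->
  (x = u /\ y = v) \/ (x = v /\ y = u).
Proof.
move=> E; have := set22 u v; have := set21 u v; rewrite -E.
have := set22 x y; have := set21 x y; rewrite {1 2}E.
move=> /set2P xE /set2P yE /set2P uE /set2P vE.
by intuition congruence.
Qed.

Lemma dropped_adj p q (i : inj p q) (G : el_graph q) :
  subrel (dropped i G) (@adj G).
Proof.
move=> x y /existsP[a /andP[/eqP aE _]].
case: (adj_tree G) => _ adjC _ _ _.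
have [u [v [uv]]] := edge_ends a.
by rewrite aE => /pair_eq[] [-> ->] //; rewrite adjC.
Qed.

Lemma dropped_set p q (i : inj p q) (G : el_graph q) (x y x' y' : vert G) :
  [set x; y] = [set x'; y'] -> dropped i G x y -> dropped i G x' y'.
Proof. by rewrite /dropped /= => ->. Qed.

Lemma contraction_exists p q (i : inj p q) (G : el_graph q) :
  exists H, contracts i G H.
Proof.
have dS : symmetric (dropped i G).
  by move=> x y; rewrite /dropped /= setUC.
have [k [c [csurj cE]]] := quotient_map dS.
have T := adj_tree G; have dsub := @dropped_adj _ _ i G.
have dset := @dropped_set _ _ i G.
have gtree := contr_tree T dsub dset csurj cE.
have gval := contr_val T dsub dset csurj cE.
have guniq := contr_uniq T dsub dset cE.
have gloop := contr_noloop T dsub dset cE.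
pose e' : rel 'I_k := contr_adj (@adj G) c.
have gst v : (0 < #|e' v|%:R - 2 +
    weight w [set j | (c \o mark G) j == v])%R.
  have := gval v; set B := [set x | c x == v] => valB.
  have wB : weight w [set j | (c \o mark G) j == v] =
      (\sum_(x in B) weight w [set j | mark G j == x])%R.
    rewrite /weight (partition_big (mark G) (mem B)) /=; last first.
      by move=> j; rewrite !inE.
    apply: eq_bigr => x; rewrite inE => /eqP xv; apply: eq_bigl => j.
    rewrite !inE /=; have [->|_] := eqVneq (mark G j) x; last by rewrite andbF.
    by rewrite xv eqxx.
  have sB : (0 < \sum_(x in B)
      (#|adj x|%:R - 2 + weight w [set j | mark G j == x] : rat))%R.
    have [x0 x0v] := csurj v.
    have x0B : x0 \in B by rewrite inE x0v.
    rewrite (bigD1 x0) //= ltr_pwDl ?stableP // sumr_ge0 // => x _.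
    by rewrite ltW ?stableP.
  apply: lt_le_trans sB _; rewrite big_split /= -wB lerD2r big_split /=.
  have sum2 : (\sum_(x in B) 2 = (2 * #|B|)%:R :> rat)%R.
    by rewrite sumr_const -mulrnA.
  rewrite sumrN sum2 -natr_sum lerBlDr addrAC lerBrDr.
  by rewrite -!natrD ler_nat.
pose H0 := StableGraph gtree gst.
have lift_edge (b : edge H0) : exists a : edge G, val b = c @: val a.
  have [u [v [/andP[uv]]]] := edge_ends b.
  move=> /existsP[x /existsP[y /and3P[xy /eqP cx /eqP cy]]] bE.
  have [a aE] := mk_edge xy.
  by exists a; rewrite aE bE imset_pair cx cy.
have ends_ne (b : edge H0) x y : val b = [set c x; c y] -> c x != c y.
  have [u [v [/andP[uv _] ->]]] := edge_ends b => uvE.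
  apply: contraNneq uv => cxy; move: uvE; rewrite cxy setUid => /setP uvE.
  have := uvE u; have := uvE v.
  by rewrite !inE !eqxx /= ?orbT => /esym/eqP-> /esym/eqP->.
have edge_uniq (a1 a2 : edge G) (b : edge H0) :
    val b = c @: val a1 -> val b = c @: val a2 -> a1 = a2.
  have [x [y [xy aE]]] := edge_ends a1; have [x' [y' [xy' aE']]] := edge_ends a2.
  rewrite aE aE' !imset_pair => b1 b2; apply: val_inj; rewrite aE aE'.
  have cxy := ends_ne _ _ _ b1; have cxy' := ends_ne _ _ _ b2.
  move: b2; rewrite b1 => /setP E; have := E (c x); have := E (c y).
  rewrite !inE !eqxx orbT /= => /esym/orP[]/eqP cy /esym/orP[]/eqP cx.
  - by rewrite cx cy eqxx in cxy.
  - have xy'' : adj y' x' by case: T => _ -> _ _ _.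
    by have [-> ->] := guniq _ _ _ _ xy xy'' cx cy cxy; rewrite setUC.
  - by have [-> ->] := guniq _ _ _ _ xy xy' cx cy cxy.
  - by rewrite cx cy eqxx in cxy.
have /choice[l lP] (b : edge H0) :
    exists j, exists a : edge G, val b = c @: val a /\ i j = lab a.
  have [a ba] := lift_edge b; suff /codomP[j jE] : lab a \in codom i.
    by exists j, a.
  have [x [y [xy aE]]] := edge_ends a.
  move: ba; rewrite aE imset_pair => /ends_ne; apply: contraNT.
  by rewrite -(droppedE i aE) cE => /connect1.
have linj : injective l.
  move=> b1 b2 b12; have [a1 [bE1 lE1]] := lP b1; have [a2 [bE2 lE2]] := lP b2.
  apply: val_inj; rewrite bE1 bE2; suff -> : a1 = a2 by [].
  by apply: (bij_inj (lab_bij G)); rewrite -lE1 -lE2 b12.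
have lsurj j : exists b, l b = j.
  have [g _ gK] := lab_bij G; pose a := g (i j).
  have aj : lab a = i j by apply: gK.
  have [x [y [xy aE]]] := edge_ends a.
  have cxy : c x != c y.
    apply/eqP => /(gloop _ _ xy); rewrite (droppedE i aE) aj.
    by rewrite codom_f.
  have [|b bE] := @mk_edge H0 (c x) (c y).
    rewrite /= /contr_adj /= cxy; apply/existsP; exists x.
    by apply/existsP; exists y; rewrite xy !eqxx.
  exists b; have [a' [bE' lE]] := lP b.
  apply: (@inj_funP _ _ i); rewrite lE -aj; congr lab.
  by apply: edge_uniq bE' _; rewrite aE imset_pair.
have lbij : bijective l.
  have [g gP] := choice lsurj; exists g => // b.
  by apply: linj; rewrite gP.
exists (ELGraph lbij), c; split=> //.
move=> a b ba; have [a' [ba' lE]] := lP b.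
by rewrite -(edge_uniq _ _ _ ba' ba) -lE.
Qed.

Lemma contraction_iso p q (i : inj p q) (G G' : el_graph q) (H H' : el_graph p) :
  el_iso G G' -> contracts i G H -> contracts i G' H' -> el_iso H H'.
Proof.
case=> f [fbij fadj fmark] flab [c cP] [c' cP'].
have [f' fK f'K] := fbij.
have edge_im (a : edge G) : exists2 a' : edge G', val a' = f @: val a & lab a' = lab a.
  have [x [y [xy aE]]] := edge_ends a.
  have [|a' a'E] := @mk_edge G' (f x) (f y); first by rewrite fadj.
  have aa' : val a' = f @: val a by rewrite a'E aE imset_pair.
  by exists a' => //; apply: flab.
have fdrop x y : dropped i G' (f x) (f y) = dropped i G x y.
  apply/idP/idP => [h|/existsP[a /andP[/eqP aE la]]]; last first.
    have [a' a'E la'] := edge_im a; apply/existsP; exists a'.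
    by rewrite a'E aE imset_pair eqxx la' la.
  have := dropped_adj h; rewrite fadj => xy.
  have [a aE] := mk_edge xy; have [a' a'E la'] := edge_im a.
  by move: h; rewrite aE imset_pair in a'E; rewrite (droppedE i a'E) (droppedE i aE) la'.
have fconn x y : connect (dropped i G') (f x) (f y) = connect (dropped i G) x y.
  apply/idP/idP => /connectP[s sP].
    rewrite -{2}(fK y) => ->; rewrite -{1}(fK x).
    elim: s (f x) sP => //= z s IH t /andP[tz /IH]; apply: connect_trans.
    by apply: connect1; rewrite -fdrop !f'K.
  move=> ->; elim: s x sP => //= z s IH t /andP[tz /IH]; apply: connect_trans.
  by apply: connect1; rewrite fdrop.
have [s sP] := choice (ctr_surj cP); have [s' sP'] := choice (ctr_surj cP').
pose g u := c' (f (s u)); pose g' u := c (f' (s' u)).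
have gE x : g (c x) = c' (f x).
  by apply/eqP; rewrite (ctr_fiber cP') fconn -(ctr_fiber cP) sP.
have gE' x : g' (c' x) = c (f' x).
  apply/eqP; rewrite (ctr_fiber cP) -fconn !f'K -(ctr_fiber cP').
  by rewrite sP'.
have gK : cancel g g' by move=> u; rewrite /g gE' fK sP.
have g'K : cancel g' g by move=> u; rewrite /g' gE f'K sP'.
exists g.
  split=> [|u v|k]; first by exists g'.
    rewrite (ctr_adj cP) (ctr_adj cP') (can_eq gK); congr andb.
    apply/existsP/existsP => -[x /existsP[y /and3P[xy /eqP cx /eqP cy]]].
      exists (f' x); apply/existsP; exists (f' y).
      by rewrite -fadj !f'K xy -!(can_eq gK) !gE !f'K cx cy !eqxx.
    by exists (f x); apply/existsP; exists (f y); rewrite fadj xy -cx -cy !gE !eqxx.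
  by rewrite (ctr_mark cP') (ctr_mark cP) fmark gE.
move=> b b' bb'; have [u [v [uv bE]]] := edge_ends b.
have := uv; rewrite (ctr_adj cP) => /andP[_ /existsP[x /existsP[y]]].
case/and3P=> xy /eqP cx /eqP cy; have [a aE] := mk_edge xy.
have [a' a'E la'] := edge_im a.
apply: (@inj_funP _ _ i); rewrite (ctr_lab cP' (a := a')); last first.
  by rewrite bb' a'E bE aE !imset_pair -!gE cx cy.
by rewrite la' (ctr_lab cP (a := a)) // bE aE imset_pair cx cy.
Qed.

Lemma contraction_id p (G : el_graph p) : contracts (inj_id p) G G.
Proof.
have nd : dropped (inj_id p) G =2 (fun _ _ => false).
  move=> x y; apply/existsP => -[a /andP[_ /codomP]]; apply.
  by exists (lab a); rewrite inj_idE.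
exists id; split=> //.
- by move=> u; exists u.
- move=> x y; rewrite (eq_connect nd); apply/eqP/connectP => [->|].
    by exists [::].
  by case=> -[|z s] //= _ ->.
- move=> u v; have [<-|uv] := eqVneq u v => /=.
    by case: (adj_tree G) => _ _ ->.
  apply/idP/existsP => [uva|[x /existsP[y /and3P[xy /eqP<- /eqP<-]]]] //.
  by exists u; apply/existsP; exists v; rewrite uva !eqxx.
- by move=> a b; rewrite imset_id inj_idE => /val_inj->.
Qed.

Lemma contraction_comp p q r (g : inj q r) (f : inj p q)
    (G : el_graph r) (H : el_graph q) (K : el_graph p) :
  contracts g G H -> contracts f H K -> contracts (inj_comp g f) G K.
Proof.
move=> [c cP] [c' cP'].
have cadj x y : adj x y -> c x != c y -> adj (c x) (c y).
  move=> xy cxy; rewrite (ctr_adj cP) cxy; apply/existsP; exists x.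
  by apply/existsP; exists y; rewrite xy !eqxx.
have codE (j : 'I_q.+1) : (g j \in codom (inj_comp g f)) = (j \in codom f).
  apply/codomP/codomP => -[k kE]; exists k; last by rewrite inj_compE kE.
  by apply: (@inj_funP _ _ g); rewrite kE inj_compE.
exists (c' \o c); split.
- move=> u; have [v <-] := ctr_surj cP' u; have [x <-] := ctr_surj cP v.
  by exists x.
- move=> x y /=; rewrite (ctr_fiber cP').
  have lift a b : c a = c b -> connect (dropped (inj_comp g f) G) a b.
    move=> /eqP; rewrite (ctr_fiber cP); apply: connect_sub => {a b} a b.
    case/existsP => t /andP[tE tN]; apply: connect1; apply/existsP; exists t.
    rewrite tE; apply: contra tN => /codomP[j ->].
    by rewrite inj_compE codom_f.
  apply/idP/idP => /connectP[s].
    move: {2 3 4}(c x) (erefl (c x)) => u.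
    elim: s u x => [|v s IH] u x cx /=.
      by move=> _ cy; apply: lift; rewrite cx cy.
    case/andP=> uv sP yE.
    have := dropped_adj uv; rewrite (ctr_adj cP).
    case/andP => _ /existsP[a /existsP[b /and3P[ab /eqP ca /eqP cb]]].
    apply: (@connect_trans _ _ a); first by apply: lift; rewrite ca.
    apply: (@connect_trans _ _ b); last exact: IH cb sP yE.
    have [t tE] := mk_edge ab; apply: connect1; rewrite (droppedE _ tE).
    case/existsP: uv => t' /andP[/eqP t'E].
    rewrite -(ctr_lab cP (a := t) (b := t')) ?codE //.
    by rewrite t'E tE imset_pair ca cb.
  elim: s x => [x _ ->//|z s IH x /= /andP[xz sP] yE].
  apply: connect_trans (IH _ sP yE) => {IH sP yE}.
  have [->//|cxz] := eqVneq (c x) (c z).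
  have xz' := dropped_adj xz.
  have [t tE] := mk_edge xz'; have [t' t'E] := mk_edge (cadj _ _ xz' cxz).
  apply: connect1; rewrite (droppedE _ t'E).
  move: xz; rewrite (droppedE _ tE) -(ctr_lab cP (a := t) (b := t')) ?codE //.
  by rewrite t'E tE imset_pair.
- move=> u v; rewrite (ctr_adj cP'); apply/andP/andP => -[uv].
    case/existsP=> a /existsP[b /and3P[+ /eqP ca /eqP cb]].
    rewrite (ctr_adj cP) => /andP[_] /existsP[x /existsP[y]].
    case/and3P=> xy /eqP cx /eqP cy; split=> //; apply/existsP; exists x.
    by apply/existsP; exists y; rewrite xy /= cx cy ca cb !eqxx.
  case/existsP=> x /existsP[y /and3P[xy /eqP /= cx /eqP /= cy]]; split=> //.
  apply/existsP; exists (c x); apply/existsP; exists (c y).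
  rewrite cx cy !eqxx !andbT cadj //.
  by apply: contraNneq uv => cxy; rewrite -cx -cy cxy.
- by move=> k; rewrite (ctr_mark cP') (ctr_mark cP).
- move=> a b; have [x [y [xy aE]]] := edge_ends a.
  rewrite aE imset_pair -[(c' \o c) x]/(c' (c x)) -[(c' \o c) y]/(c' (c y)).
  move=> bE.
  have cxy : c x != c y.
    have [u [v [uv]]] := edge_ends b; rewrite bE => /pair_eq uvE.
    case: (adj_tree K) => _ _ Kirr _ _; apply: contraTneq uv => cxy.
    have -> : u = v by case: uvE => -[<- <-]; rewrite cxy.
    by rewrite Kirr.
  have [t tE] := mk_edge (cadj _ _ xy cxy).
  rewrite inj_compE (ctr_lab cP' (a := t)); last first.
    by rewrite bE tE imset_pair.
  by apply: (ctr_lab cP); rewrite tE aE imset_pair.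
Qed.

(* A contraction is unique up to isomorphism (contraction_iso), so that
   class_pull below does not depend on the choice made here. *)
Definition contract p q (i : inj p q) (G : el_graph q) : el_graph p :=
  sval (cid (contraction_exists i G)).

Lemma contractP p q (i : inj p q) (G : el_graph q) :
  contracts i G (contract i G).
Proof. exact: svalP (cid (contraction_exists i G)). Qed.



Definition class_pull p q (i : inj p q) (x : el_class q) : el_class p :=
  \pi_(el_class p) (contract i (generic_quotient.repr x)).

Lemma el_classP p (G H : el_graph p) :
  \pi_(el_class p) G = \pi_(el_class p) H <-> el_iso G H.
Proof. by split=> [/eqmodP/asboolP|h]; last exact/eqmodP/asboolP. Qed.

Lemma class_pullE p q (i : inj p q) (G : el_graph q) (H : el_graph p) :
  contracts i G H -> class_pull i (\pi_(el_class q) G) = \pi_(el_class p) H.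
Proof.
move=> GH; apply/el_classP; apply: contraction_iso (contractP i _) GH.
by apply/el_classP; rewrite reprK.
Qed.

Fact class_pull_id p (x : el_class p) : class_pull (inj_id p) x = x.
Proof. by rewrite -[x]reprK (class_pullE (contraction_id _)). Qed.

Fact class_pull_comp p q r (g : inj q r) (f : inj p q) (x : el_class r) :
  class_pull (inj_comp g f) x = class_pull f (class_pull g x).
Proof.
have c1 := contractP g (generic_quotient.repr x); have c2 := contractP f (contract g (generic_quotient.repr x)).
rewrite -[x]reprK (class_pullE c1) (class_pullE c2).
exact: class_pullE (contraction_comp c1 c2).
Qed.

Definition Delta0 : symDelta := SymDelta class_pull_id class_pull_comp.

End StableGraphs.

(* Main.v *)
(** An edge of a w-stable tree is recorded by its split, the bipartition of the
    markings obtained by deleting it; for these weights the splits are the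
    bipartitions whose sides both have at least two elements and contain a heavy
    one. A labelled tree is determined by its splits: a vertex is the choice of
    a side of every edge such that the chosen halves meet pairwise (Helly), and
    by stability two halves meet iff they share a marking. Two distinct splits
    bound a 1-simplex iff they are compatible, so an automorphism of the complex
    is a permutation of the splits that preserves compatibility. The splits
    compatible with the most others are the cells {h, l} with h heavy and l
    light. Two cells are incompatible iff they share exactly one element, and
    sharing a heavy element can be told from sharing a light one, so the
    automorphism acts on the cells through a permutation s preserving heaviness.
    As {h, l} is compatible with A iff h and l lie on the same side of A, it
    acts on all splits through s. *)
From mathcomp Require Import all_boot all_order all_algebra all_fingroup all_solvable.
From mathcomp Require Import boolp zify lra.
Require Import Defs.

Set Implicit Arguments.
Unset Strict Implicit.
Unset Printing Implicit Defensive.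

Import Order.TTheory GRing.Theory Num.Theory.

(** * Rigidity of the compatibility relation on splits *)

Section SplitRigidity.
Variables (T : finType) (H : {set T}).
Implicit Types A B C : {set T}.

(** For the weights of the theorem this says that [A] weighs more than 1 ([eps_weight_gt1]), as the
    markings beyond an edge must. *)
Definition stable_side A := (A :&: H != set0) && (1 < #|A|).
Definition split_side A := stable_side A && stable_side (~: A).
(** One of the four corners of the two bipartitions is empty: the condition for two splits to occur
    in one tree. *)
Definition compat A B :=
  [|| A \subset B, B \subset A, A \subset ~: B | ~: A \subset B].

Lemma stable_sideS A B : A \subset B -> stable_side A -> stable_side B.
Proof.
move=> AB /andP[/set0Pn[x]]; rewrite inE => /andP[xA xH] A2; apply/andP; split.
  by apply/set0Pn; exists x; rewrite inE xH (subsetP AB).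
exact: leq_trans A2 (subset_leq_card AB).
Qed.

Lemma split_sideC A : split_side (~: A) = split_side A.
Proof. by rewrite /split_side setCK andbC. Qed.

Lemma compatC A B : compat A B = compat B A.
Proof. by rewrite /compat orbCA subsetC subCset. Qed.

Lemma compatCr A B : compat A (~: B) = compat A B.
Proof.
by rewrite /compat setCK setCS (subCset B); do !case: (_ \subset _).
Qed.

Lemma compatCl A B : compat (~: A) B = compat A B.
Proof. by rewrite compatC compatCr compatC. Qed.

(** * Degrees in the compatibility graph *)

Definition stable_subs A := [set B : {set T} | (B \subset A) && stable_side B].

(** The subsets of [A] that fail to be stable are those without heavy elements and the heavy
    singletons. *)
Lemma card_stable_subs A :
  #|stable_subs A| + 2 ^ #|A :\: H| + #|A :&: H| = 2 ^ #|A|.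
Proof.
have sub1 : powerset (A :\: H) \subset powerset A by rewrite powersetS subsetDl.
have c1 := cardsID (powerset (A :\: H)) (powerset A).
rewrite (setIidPr sub1) !card_powerset in c1.
set D := powerset A :\: _ in c1; pose S := [set [set x] | x in A :&: H].
have S1 : #|S| = #|A :&: H| by rewrite card_imset //; apply: set1_inj.
have SD : S \subset D.
  apply/subsetP => _ /imsetP[x /setIP[xA xH] ->].
  by rewrite !inE !sub1set !inE xA xH.
have c2 := cardsID S D; rewrite (setIidPr SD) S1 in c2.
suff -> : stable_subs A = D :\: S by rewrite -c1 -c2; lia.
apply/setP => B; rewrite !inE subsetD -setI_eq0 /stable_side.
have [BA|_] /= := boolP (B \subset A); last by rewrite !andbF.
have [_|/set0Pn[x]] /= := eqVneq (B :&: H) set0; first by rewrite !andbF.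
rewrite inE /= !andbT => /andP[xB xH]; rewrite ltnNge; congr negb.
apply/idP/imsetP => [B1|[y _ ->]]; last by rewrite cards1.
exists x; first by rewrite inE xH (subsetP BA).
by apply/eqP; rewrite eq_sym eqEcard sub1set xB cards1.
Qed.

Definition degree A := #|[set B | split_side B && compat A B]|.

(** A side is compatible with [A] iff it or its complement lies inside [A] or inside [~: A]. Adding
    complements doubles the number of stable subsets, except that [A] and [~: A] arise twice. *)
Lemma degreeE A : split_side A ->
  degree A + 2 = 2 * (#|stable_subs A| + #|stable_subs (~: A)|).
Proof.
move=> /andP[sA sA']; set X := stable_subs A :|: stable_subs (~: A).
have [a aA] : exists a, a \in A by case/andP: sA => /set0Pn[x /setIP[]]; exists x.
have [b bA] : exists b, b \in ~: A.
  by case/andP: sA' => /set0Pn[x /setIP[]]; exists x.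
have disjX : stable_subs A :&: stable_subs (~: A) = set0.
  apply/setP => B; rewrite !inE; apply/negP => /andP[/andP[BA]].
  case/andP=> /set0Pn[x /setIP[xB _]] _ /andP[/subsetP/(_ x xB)].
  by rewrite inE (subsetP BA).
have cX : #|X| = #|stable_subs A| + #|stable_subs (~: A)|.
  by rewrite cardsU disjX cards0 subn0.
suff SE : [set B | split_side B && compat A B] = X :|: [set ~: B | B in X].
  rewrite /degree SE cardsU card_imset ?cX; last exact: setC_inj.
  have -> : X :&: [set ~: B | B in X] = [set A; ~: A].
    apply/setP => B; rewrite !inE; apply/idP/idP; last first.
      case/pred2P => ->.
        rewrite sA subxx /=; apply/imsetP; exists (~: A); last by rewrite setCK.
        by rewrite !inE subxx sA' orbT.
      rewrite sA' subxx orbT; apply/imsetP; exists A => //.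
      by rewrite !inE subxx sA.
    case/andP=> BX /imsetP[C]; rewrite !inE => CX BE; move: CX BX.
    rewrite -(setCK C) -BE; case/orP => /andP[CA _] /orP[] /andP[BA _].
    - by have := subsetP BA b; have := subsetP CA b; move: bA; rewrite !inE;
         case: (b \in B) => //= /negPf->; [move=> _ /(_ isT)|move=> /(_ isT)].
    - by apply/orP; right; rewrite eqEsubset BA -setCS setCK CA.
    - by apply/orP; left; rewrite eqEsubset BA -setCS CA.
    - by have := subsetP BA a; have := subsetP CA a; rewrite !inE aA;
         case: (a \in B) => //=; [move=> _ /(_ isT)|move=> /(_ isT)].
  rewrite cards2; have -> : A != ~: A.
    by apply/eqP => /setP/(_ a); rewrite inE aA.
  have : 0 < #|X| by apply/card_gt0P; exists A; rewrite !inE subxx sA.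
  by rewrite cX; lia.
apply/setP => B; rewrite !inE; apply/idP/idP.
  case/andP=> /andP[sB sB'] /or4P[] AB.
  - apply/orP; right; apply/imsetP; exists (~: B); last by rewrite setCK.
    by rewrite !inE sB' setCS AB orbT.
  - by rewrite AB sB.
  - by rewrite sB (subsetC B) AB !orbT.
  - apply/orP; right; apply/imsetP; exists (~: B); last by rewrite setCK.
    by rewrite !inE sB' (subCset B) AB.
have XP C : C \in X -> split_side C && compat A C.
  rewrite !inE => /orP[] /andP[CA sC].
    rewrite /split_side sC (stable_sideS _ sA') ?setCS //.
    by rewrite /compat CA orbT.
  rewrite /split_side sC (stable_sideS _ sA); last by rewrite subsetC.
  by rewrite /compat (subsetC A) CA !orbT.
case/orP=> [BX|/imsetP[C CX ->]]; first by apply: XP; rewrite !inE.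
by rewrite split_sideC compatCr XP.
Qed.

Lemma exp2_gt0 k : 0 < 2 ^ k. Proof. by rewrite expn_gt0. Qed.

(** The inequality behind [degree_lt_cell] when the side with [h] heavy elements has no light ones;
    the next lemma treats light elements on both sides. *)
Lemma light_side_bound h h' l' : 1 < h -> 0 < h' -> 1 < l' ->
  2 ^ h + 2 ^ (h' + l') + 2 ^ l'.-1 < 3 + 2 ^ (h + h' + l').-2 + 2 ^ l'.
Proof.
case: h => [|[|h]] // _; case: h' => // h' _; case: l' => [|[|l]] // _.
rewrite (_ : (h.+2 + h'.+1 + l.+2).-2 = h + h' + l + 3)%N /=; last lia.
rewrite addSn !addnS !expnS !expnD; move: (exp2_gt0 h) (exp2_gt0 h') (exp2_gt0 l).
by move: (2 ^ h) (2 ^ h') (2 ^ l) => p q M; clear; nia.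
Qed.

Lemma mixed_side_bound h h' l l' : 0 < h -> 0 < h' -> 0 < l -> 0 < l' ->
  (h, l) != (1, 1) -> (h', l') != (1, 1) ->
  2 ^ (h + l) + 2 ^ (h' + l') + 2 ^ (l + l').-1 <
  2 + 2 ^ (h + h' + l + l').-2 + 2 ^ l + 2 ^ l'.
Proof.
case: h => // h _; case: h' => // h' _; case: l => // l _; case: l' => // l' _.
rewrite !xpair_eqE /= !eqSS => hl hl'.
rewrite (_ : (h.+1 + h'.+1 + l.+1 + l'.+1).-2 = h + h' + l + l' + 2)%N /=; last lia.
rewrite !addSn !addnS !expnS !expnD.
have e1 k : 2 ^ k = 1 \/ 2 <= 2 ^ k.
  by case: k => [|k]; [left | right; rewrite expnS; have := exp2_gt0 k; lia].
have e0 k : 2 ^ k = 1 -> k = 0.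
  by case: k => // k; rewrite expnS; have := exp2_gt0 k; lia.
have hl1 : ~ (2 ^ h = 1 /\ 2 ^ l = 1) by case=> /e0 h0 /e0 l0; rewrite h0 l0 in hl.
have hl2 : ~ (2 ^ h' = 1 /\ 2 ^ l' = 1).
  by case=> /e0 h0 /e0 l0; rewrite h0 l0 in hl'.
(* With P = p y and Q = q z the difference of the two sides is
   4 (P - 1) (Q - 1) - 2 (y - 1) (z - 1), and P >= y, Q >= z, P, Q >= 2. *)
move: hl1 hl2 (e1 h) (e1 h') (e1 l) (e1 l').
move: (2 ^ h) (2 ^ h') (2 ^ l) (2 ^ l') => p q y z; clear => A B p1 q1 y1 z1.
have prodP u v : ~ (u = 1 /\ v = 1) -> u = 1 \/ 2 <= u -> v = 1 \/ 2 <= v ->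
    exists a, [/\ u * v = a.+1, v <= a.+1 & 0 < a].
  move=> uv u1 v1; have u0 : 0 < u by lia.
  have uv1 : v <= u * v by rewrite leq_pmull.
  have uv2 : u <= u * v by rewrite leq_pmulr //; lia.
  by exists (u * v).-1; split; lia.
have [a [pa ya a1]] := prodP _ _ A p1 y1.
have [b [qb zb b1]] := prodP _ _ B q1 z1.
have ab1 : 0 < a * b by rewrite muln_gt0 a1 b1.
have yz : y.-1 * z.-1 <= a * b by apply: leq_mul; lia.
have yzE : y.-1 * z.-1 + y + z = y * z + 1.
  have [y0 z0] : 0 < y /\ 0 < z by lia.
  by rewrite -(prednK y0) -(prednK z0) /=; lia.
have pqE : (p * y) * (q * z) = a * b + a + b + 1 by rewrite pa qb; lia.
move: pa qb pqE yz yzE ab1; clear; lia.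
Qed.

(** * Cells as the splits of largest degree *)

Hypotheses (H2 : 1 < #|H|) (L2 : 1 < #|~: H|) (T5 : 4 < #|T|).

Definition cell A := (#|A :&: H| == 1) && (#|A :\: H| == 1).

Lemma cellP A : reflect (exists h l, [/\ h \in H, l \notin H & A = [set h; l]]) (cell A).
Proof.
apply: (iffP andP) => [[/cards1P[h hE] /cards1P[l lE]]|[h [l [hH lH ->]]]].
  exists h, l; split.
  - by have := set11 h; rewrite -hE inE => /andP[].
  - by have := set11 l; rewrite -lE inE => /andP[].
  - by rewrite -(setID A H) hE lE.
split; apply/cards1P; [exists h|exists l]; apply/setP => x; rewrite !inE.
  have [->|_] /= := eqVneq x h; first by rewrite hH.
  by have [->|//] := eqVneq x l; rewrite (negPf lH).
have [->|_] := eqVneq x l; first by rewrite lH orbT.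
by rewrite orbF; have [->|_] := eqVneq x h; rewrite ?hH ?andbF.
Qed.

Lemma card_sideE A : #|A| = #|A :&: H| + #|A :\: H|.
Proof. by rewrite cardsID. Qed.

Lemma card_heavyC A : #|A :&: H| + #|~: A :&: H| = #|H|.
Proof. by rewrite -(cardsID A H) setIC [~: A :&: H]setIC setDE. Qed.

Lemma card_lightC A : #|A :\: H| + #|~: A :\: H| = #|~: H|.
Proof. by rewrite -(cardsID A (~: H)) !setDE setIC [~: A :&: _]setIC. Qed.

Lemma cell_split A : cell A -> split_side A.
Proof.
case/andP => /eqP hA /eqP lA; rewrite /split_side /stable_side -!card_gt0.
have := card_heavyC A; have := card_lightC A.
rewrite (card_sideE A) (card_sideE (~: A)) hA lA; move: (cardsC H); lia.
Qed.

(** The only stable subset of a cell is itself, so nearly all of its degree comes from its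
    complement. In terms of the heavy and light counts [h], [l] and [h'], [l'] of the two sides of
    [A], the linear terms cancel and an inequality between powers of two remains. *)
Lemma degree_lt_cell A C : split_side A -> cell C -> ~~ cell A -> ~~ cell (~: A) ->
  degree A < degree C.
Proof.
move=> sA cC nA nA'; have := degreeE sA; have := degreeE (cell_split cC).
have := card_stable_subs A; have := card_stable_subs (~: A).
have := card_stable_subs C; have := card_stable_subs (~: C).
have := card_heavyC A; have := card_lightC A.
have := card_heavyC C; have := card_lightC C.
case/andP: cC => /eqP hC /eqP lC.
move: sA nA nA'; rewrite /split_side /stable_side /cell -!card_gt0.
rewrite (card_sideE A) (card_sideE (~: A)) (card_sideE C) (card_sideE (~: C)) hC lC.
move: (#|A :&: H|) (#|~: A :&: H|) (#|A :\: H|) (#|~: A :\: H|) => h h' l l'.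
case/andP => /andP[h0 hl0] /andP[h0' hl0'] nA nA' mC nC mA nAE.
have -> : #|~: C :&: H| = (h + h').-1 by lia.
have -> : #|~: C :\: H| = (l + l').-1 by lia.
have -> : (h + h').-1 + (l + l').-1 = (h + h' + l + l').-2 by lia.
suff : 2 ^ (h + l) + 2 ^ (h' + l') + 2 ^ (l + l').-1 <
  2 + 2 ^ (h + h' + l + l').-2 + 2 ^ l + 2 ^ l' by lia.
have [l0|l0] := posnP l.
  have := @light_side_bound h h' l'; rewrite l0 !addn0 add0n expn0; lia.
have [l0'|l0'] := posnP l'.
  have := @light_side_bound h' h l; rewrite l0' !addn0 expn0 (addnC h' h); lia.
by apply: mixed_side_bound => //; rewrite xpair_eqE.
Qed.

(** A side has at least two elements, so it lies in the cell only if it equals it; otherwise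
    compatibility means that the cell lies in [A] or in [~: A]. *)
Lemma cell_compat h l A : h \in H -> l \notin H -> split_side A ->
  compat [set h; l] A = ((h \in A) == (l \in A)).
Proof.
move=> hH lH /andP[/andP[_ A2] /andP[_ A2']].
have hl : h != l by apply: contraNneq lH => <-.
have c2 : #|[set h; l]| = 2 by rewrite cards2 hl.
rewrite /compat (subCset _ A); apply/idP/eqP; last first.
  rewrite !subUset !sub1set !inE.
  by move=> ->; case: (l \in A); rewrite ?orbT.
case/or4P.
- by rewrite subUset !sub1set => /andP[-> ->].
- move=> As; have : A == [set h; l] by rewrite eqEcard As c2.
  by move/eqP->; rewrite set21 set22.
- by rewrite subUset !sub1set !inE => /andP[/negPf-> /negPf->].
- move=> As; have : ~: A == [set h; l] by rewrite eqEcard As c2.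
  move/eqP/setP => E; have := E h; have := E l.
  by rewrite !inE !eqxx orbT => /negPf-> /negPf->.
Qed.

(** * Maps of splits that preserve compatibility *)

Record split_morphism (F : {set T} -> {set T}) : Prop := SplitMorphism {
  morph_side : forall A, split_side A -> split_side (F A);
  morph_setC : forall A, split_side A -> F (~: A) = ~: F A;
  morph_compat : forall A B, split_side A -> split_side B ->
    compat A B -> compat (F A) (F B) }.

Definition split_inverse (F G : {set T} -> {set T}) :=
  forall A, split_side A -> G (F A) = A.

Section Morphism.
Variables F G : {set T} -> {set T}.
Hypotheses (Fm : split_morphism F) (Gm : split_morphism G).
Hypothesis FK : split_inverse F G.

Lemma morph_compatE A B : split_side A -> split_side B ->
  compat (F A) (F B) = compat A B.
Proof.
move=> sA sB; apply/idP/idP; last exact: (morph_compat Fm).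
by move/(morph_compat Gm (morph_side Fm sA) (morph_side Fm sB)); rewrite !FK.
Qed.

(** [F] is injective on split sides and embeds the neighbours of [A] among those of [F A]. *)
Lemma morph_degree A : split_side A -> degree A <= degree (F A).
Proof.
move=> sA; rewrite /degree -(card_in_imset (f := F)); last first.
  move=> B C; rewrite !inE => /andP[sB _] /andP[sC _] /(congr1 G).
  by rewrite !FK.
apply/subset_leq_card/subsetP => C /imsetP[B + ->{C}].
rewrite inE => /andP[sB AB].
by rewrite inE (morph_side Fm) // (morph_compat Fm).
Qed.

Lemma morph_cell A : cell A -> cell (F A) || cell (~: F A).
Proof.
move=> cA; have sA := cell_split cA; have sFA := morph_side Fm sA.
apply: contraT; rewrite negb_or => /andP[n1 n2].
have := degree_lt_cell sFA cA n1 n2.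
by rewrite ltnNge morph_degree.
Qed.

End Morphism.

Definition is_cell (p : T * T) := (p.1 \in H) && (p.2 \notin H).
Definition cell_set (p : T * T) : {set T} := [set p.1; p.2].

(** [F] may send a cell to the complement of a cell; [f] forgets this choice of side. Nothing is
    required of [f] off the cells. *)
Definition cell_map (F : {set T} -> {set T}) (f : T * T -> T * T) :=
  forall p, is_cell p -> is_cell (f p) /\
    (F (cell_set p) = cell_set (f p) \/ F (cell_set p) = ~: cell_set (f p)).

Lemma cell_cell_set p : is_cell p -> cell (cell_set p).
Proof. by case: p => h l /andP[hH lH]; apply/cellP; exists h, l. Qed.

Lemma split_cell_set p : is_cell p -> split_side (cell_set p).
Proof. by move/cell_cell_set/cell_split. Qed.

Lemma cell_map_exists F G : split_morphism F -> split_inverse F G ->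
  exists f, cell_map F f.
Proof.
move=> Fm FK; suff /choice[f fP] : forall p, exists q, is_cell p -> is_cell q /\
    (F (cell_set p) = cell_set q \/ F (cell_set p) = ~: cell_set q).
  by exists f.
move=> p; have [cp|ncp] := boolP (is_cell p); last by exists p.
case/orP: (morph_cell Fm FK (cell_cell_set cp)) => /cellP[h [l [hH lH E]]];
  exists (h, l) => _; split; rewrite ?/is_cell /= ?hH //.
  by left.
by right; rewrite -[LHS]setCK E.
Qed.

Lemma cell_neq p q : is_cell p -> is_cell q -> (p.1 == q.2) = false.
Proof. by case/andP=> p1 _ /andP[_ q2]; apply: contraNF q2 => /eqP<-. Qed.

(** The complement of a cell has at least three elements and so is not a cell. *)
Lemma cell_set_inj p q : is_cell p -> is_cell q ->
  cell_set p = cell_set q \/ cell_set p = ~: cell_set q -> p = q.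
Proof.
move=> cp cq [E|/(congr1 (fun A : {set T} => #|A|))].
  have := set21 p.1 p.2; have := set22 p.1 p.2; rewrite -/(cell_set p) E !inE.
  rewrite (cell_neq cp cq) orbF eq_sym (cell_neq cq cp) /= => /eqP p2 /eqP p1.
  by rewrite [p]surjective_pairing [q]surjective_pairing p1 p2.
rewrite !cards2 cell_neq // => /eqP; rewrite -(eqn_add2l #|cell_set q|) cardsC.
by rewrite cards2 cell_neq // => /eqP; move: T5; lia.
Qed.

(** For cells this is incompatibility, by [compat_cells]. *)
Definition cross (p q : T * T) := (p.1 == q.1) (+) (p.2 == q.2).

Lemma compat_cell_set p A : is_cell p -> split_side A ->
  compat (cell_set p) A = ((p.1 \in A) == (p.2 \in A)).
Proof. by case/andP => p1 p2 sA; apply: cell_compat. Qed.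

Lemma compat_cells p q : is_cell p -> is_cell q ->
  compat (cell_set p) (cell_set q) = ~~ cross p q.
Proof.
move=> cp cq; rewrite compat_cell_set ?split_cell_set // !inE.
rewrite (cell_neq cp cq) orbF (eq_sym p.2 q.1) (cell_neq cq cp) /=.
by rewrite /cross; case: (p.1 == q.1); case: (p.2 == q.2).
Qed.

Section CellMap.
Variables F G : {set T} -> {set T}.
Hypotheses (Fm : split_morphism F) (Gm : split_morphism G).
Hypothesis FK : split_inverse F G.
Variables f g : T * T -> T * T.
Hypotheses (fP : cell_map F f) (gP : cell_map G g).

Lemma cell_map_compat p A : is_cell p -> split_side A ->
  compat (cell_set (f p)) (F A) = compat (cell_set p) A.
Proof.
move=> cp sA; rewrite -[RHS](morph_compatE Fm Gm FK) ?split_cell_set //.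
by have [_ [->|->]] := fP cp; rewrite ?compatCl.
Qed.

Lemma cell_mapK p : is_cell p -> g (f p) = p.
Proof.
move=> cp; have [cfp fpE] := fP cp; have [cgfp gfpE] := gP cfp.
apply/esym/cell_set_inj => //; have sp := split_cell_set cp.
have := FK sp; have sfp := split_cell_set cfp.
case: fpE => ->; rewrite ?(morph_setC Gm) //; case: gfpE => -> <-; rewrite ?setCK;
  by [left|right].
Qed.

Lemma cell_map_cross p q : is_cell p -> is_cell q -> cross (f p) (f q) = cross p q.
Proof.
move=> cp cq; have [cfp _] := fP cp; have [cfq Eq] := fP cq; apply: negb_inj.
rewrite -!compat_cells // -(cell_map_compat cp (split_cell_set cq)).
by case: Eq => ->; rewrite ?compatCr.
Qed.

End CellMap.

(* Rows are the cells with a given heavy element, columns those with a given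
   light one. No split crosses all the cells of a column, since the side of a light
   element contains a heavy one; but if there are three heavy elements, the
   split cutting off two of them crosses all the cells of their rows. If there
   are only two heavy elements, columns have two cells and rows at least three. *)
Lemma cell_map_heavy F G f g : split_morphism F -> split_morphism G ->
  split_inverse F G -> split_inverse G F -> cell_map F f -> cell_map G g ->
  forall p q, is_cell p -> is_cell q -> p.1 = q.1 -> (f p).1 = (f q).1.
Proof.
move=> Fm Gm FK GK fP gP p q cp cq pq1.
have [->//|pq] := eqVneq p q.
have pq2 : p.2 != q.2.
  apply: contraNneq pq => pq2.
  by rewrite [p]surjective_pairing [q]surjective_pairing pq1 pq2.
have xpq : cross p q by rewrite /cross pq1 eqxx (negPf pq2).
apply/eqP; apply: contraT => fpq1.
have [cfp _] := fP _ cp; have [cfq _] := fP _ cq.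
(* Images of crossing cells cross, so they share the light element if not the heavy one. *)
have fpq2 : (f p).2 = (f q).2.
  move: xpq; rewrite -(cell_map_cross Fm Gm FK fP cp cq) /cross (negPf fpq1).
  by move/eqP.
have [n3|n2] := ltnP 2 #|H|; last first.
  have m3 : 2 < #|~: H| by move: (cardsC H) T5; lia.
  have [l lH lpq] : exists2 l, l \in ~: H & l \notin [set p.2; q.2].
    apply/subsetPn; apply: contraL m3 => /subset_leq_card.
    by rewrite cards2 pq2 -leqNgt.
  move: lpq; rewrite !inE negb_or => /andP[lp lq]; rewrite inE in lH.
  (* A third cell in the row of [p] and [q] crosses both. Its image must cross [f p] and [f q]; but
     with two heavy elements these form a whole column, and no cell crosses both cells of a
     column. *)
  have cr : is_cell (p.1, l) by case/andP: cp => p1 _; rewrite /is_cell /= p1.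
  have [cfr _] := fP _ cr.
  have : cross (f (p.1, l)) (f p).
    by rewrite (cell_map_cross Fm Gm FK fP) // /cross eqxx (negPf lp).
  have : cross (f (p.1, l)) (f q).
    by rewrite (cell_map_cross Fm Gm FK fP) // /cross pq1 eqxx (negPf lq).
  rewrite /cross fpq2; have : (f (p.1, l)).1 \in [set (f p).1; (f q).1].
    suff -> : [set (f p).1; (f q).1] = H by case/andP: cfr.
    apply/eqP; rewrite eqEcard cards2 fpq1 n2 subUset !sub1set.
    by case/andP: cfp => ->; case/andP: cfq => ->.
  rewrite !inE => /orP[]/eqP->; rewrite eqxx.
    by rewrite (negPf fpq1); case: (_ == _).
  by rewrite (eq_sym (f q).1) (negPf fpq1); case: (_ == _).
have [p1H _] := andP cp.
have [h hH hp] : exists2 h, h \in H & h \notin [set p.1].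
  apply/subsetPn; apply: contraL n3 => /subset_leq_card.
  by rewrite cards1 => ?; rewrite -leqNgt; lia.
(* The split cutting off two heavy elements: a cell compatible with it has its heavy element outside
   [s], as its light one is. *)
rewrite inE in hp; pose s := [set p.1; h].
have sc : #|s| = 2 by rewrite cards2 eq_sym hp.
have ss : split_side s.
  rewrite /split_side /stable_side sc andbT; apply/and3P; split.
  - by apply/set0Pn; exists p.1; rewrite !inE eqxx.
  - suff [k kH ks] : exists2 k, k \in H & k \notin s.
      by apply/set0Pn; exists k; rewrite inE kH andbT inE.
    apply/subsetPn; apply: contraL n3 => /subset_leq_card.
    by rewrite sc -leqNgt.
  - by move: (cardsC s) T5; rewrite sc; lia.
have sF := morph_side Fm ss.
(* Both sides of [F s] contain heavy elements, so some [k] lies on the side of [(f p).2]. The cell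
   of [k] and [(f p).2] is compatible with [F s], hence its preimage under [f] is off the row of
   [p]. *)
have [k kH kl] : exists2 k, k \in H & (k \in F s) = ((f p).2 \in F s).
  case/andP: sF => /andP[/set0Pn[a /setIP[aF aH]] _] /andP[/set0Pn[b /setIP[bF bH]] _].
  rewrite inE in bF; case: (boolP ((f p).2 \in F s)) => _; first by exists a.
  by exists b => //; apply: negbTE.
have cr : is_cell (k, (f p).2) by rewrite /is_cell /= kH; case/andP: cfp.
have [cgr _] := gP _ cr; have gK := cell_mapK Fm GK gP fP cr.
have : (g (k, (f p).2)).1 != p.1.
  have : compat (cell_set (k, (f p).2)) (F s) by rewrite compat_cell_set //= kl.
  rewrite -{1}gK (cell_map_compat Fm Gm FK fP) // compat_cell_set // => /eqP E.
  move: E; rewrite !inE; case/andP: cgr => _ r2.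
  rewrite [X in _ = X](_ : _ = false); first by case: eqP.
  by apply/negP => /orP[]/eqP E; rewrite E ?p1H ?hH in r2.
(* This preimage would share its light element with both [p] and [q], since its image shares a
   column with [f p] and [f q]. *)
move=> rp; have xr (t : T * T) : is_cell t -> t.1 = p.1 -> (f t).2 = (f p).2 ->
    (g (k, (f p).2)).2 = t.2.
  move=> ct tp ft; have [cft _] := fP _ ct.
  have kt : k != (f t).1.
    apply: contraNneq rp => kt; rewrite kt -ft -surjective_pairing.
    by rewrite (cell_mapK Gm FK fP gP) // tp.
  have : cross (k, (f p).2) (f t) by rewrite /cross /= (negPf kt) ft eqxx.
  rewrite -{1}gK (cell_map_cross Fm Gm FK fP) // /cross tp (negPf rp).
  by move/eqP.
by move: pq2; rewrite -(xr p) // -(xr q) // eqxx.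
Qed.

(** If the images shared the heavy element instead, [cell_map_heavy] for the inverse map would make
    [p] and [q] share theirs and hence coincide. *)
Lemma cell_map_light F G f g : split_morphism F -> split_morphism G ->
  split_inverse F G -> split_inverse G F -> cell_map F f -> cell_map G g ->
  forall p q, is_cell p -> is_cell q -> p.2 = q.2 -> (f p).2 = (f q).2.
Proof.
move=> Fm Gm FK GK fP gP p q cp cq pq2; have [->//|pq] := eqVneq p q.
have pq1 : p.1 != q.1.
  apply: contraNneq pq => pq1.
  by rewrite [p]surjective_pairing [q]surjective_pairing pq1 pq2.
have : cross (f p) (f q).
  by rewrite (cell_map_cross Fm Gm FK fP) // /cross pq2 eqxx (negPf pq1).
have [cfp _] := fP _ cp; have [cfq _] := fP _ cq.
rewrite /cross; case: (eqVneq (f p).1 (f q).1) => [E|_]; last by move/eqP.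
have := cell_map_heavy Gm Fm GK FK gP fP cfp cfq E.
by rewrite !(cell_mapK Gm FK fP gP) // => /eqP; rewrite (negPf pq1).
Qed.

Theorem split_rigidity F G : split_morphism F -> split_morphism G ->
  split_inverse F G -> split_inverse G F ->
  exists2 s : {perm T}, (forall x, (s x \in H) = (x \in H)) &
    forall A, split_side A -> F A = s @: A \/ F A = ~: (s @: A).
Proof.
move=> Fm Gm FK GK; have [f fP] := cell_map_exists Fm FK.
have [g gP] := cell_map_exists Gm GK.
have heavy := cell_map_heavy Fm Gm FK GK fP gP.
have light := cell_map_light Fm Gm FK GK fP gP.
have [h0 h0H] : exists h, h \in H by apply/card_gt0P; apply: ltnW.
have [l0] : exists l, l \in ~: H by apply/card_gt0P; apply: ltnW.
rewrite inE => l0H.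
have cellI h l : h \in H -> l \notin H -> is_cell (h, l).
  by rewrite /is_cell /= => -> ->.
(* By the two preceding lemmas the base elements [h0] and [l0] do not matter, so [f] acts on each
   coordinate through [s0]. *)
pose s0 x := if x \in H then (f (x, l0)).1 else (f (h0, x)).2.
have fE h l : h \in H -> l \notin H -> f (h, l) = (s0 h, s0 l).
  move=> hH lH; rewrite /s0 hH (negPf lH) [LHS]surjective_pairing.
  by congr pair; [apply: heavy|apply: light]; rewrite ?cellI.
have s0H x : (s0 x \in H) = (x \in H).
  have [xH|xH] := boolP (x \in H).
    by have [/andP[+ _] _] := fP _ (cellI _ _ xH l0H); rewrite fE.
  have [/andP[_ +] _] := fP _ (cellI _ _ h0H xH).
  by rewrite fE //= => /negPf.
have s0_inj : injective s0.
  move=> x y xy; have := s0H x; rewrite xy s0H => /esym.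
  have [xH|xH] := boolP (x \in H) => yH.
    have /(congr1 g) : f (x, l0) = f (y, l0) by rewrite !fE // xy.
    by rewrite !(cell_mapK Gm FK fP gP) ?cellI // => -[].
  have yH' : y \notin H by rewrite -yH.
  have /(congr1 g) : f (h0, x) = f (h0, y) by rewrite !fE // xy.
  by rewrite !(cell_mapK Gm FK fP gP) ?cellI // => -[].
exists (perm s0_inj) => [x|A sA]; first by rewrite permE.
have sFA := morph_side Fm sA.
(* [d] records whether passing from [A] to [F A] switches the side of [x]. Compatibility with the
   cell of [h] and [l] is preserved, so [d h = d l]; thus [d] is constant, and its value decides
   between [s @: A] and the complement. *)
pose d x := (s0 x \in F A) (+) (x \in A).
have dE h l : h \in H -> l \notin H -> d h = d l.
  move=> hH lH; have := cell_map_compat Fm Gm FK fP (cellI _ _ hH lH) sA.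
  have [cf _] := fP _ (cellI _ _ hH lH).
  rewrite !compat_cell_set ?cellI // fE //= /d.
  by do 4!case: (_ \in _).
have dc x : d x = d h0.
  have [xH|xH] := boolP (x \in H); last by rewrite (dE h0 x).
  by rewrite (dE x l0) // (dE h0 l0).
have surj y : exists x, y = perm s0_inj x.
  by exists ((perm s0_inj)^-1%g y); rewrite permKV.
case dh : (d h0); [right|left]; apply/setP => y; have [x ->] := surj y.
  have := dc x; rewrite inE mem_imset ?permE //; last exact: perm_inj.
  by rewrite dh /d; do 2!case: (_ \in _).
have := dc x; rewrite mem_imset ?permE //; last exact: perm_inj.
by rewrite dh /d; do 2!case: (_ \in _).
Qed.

End SplitRigidity.

(** * Splits of edge-labelled trees *)

Fact pt_subproof p (j : 'I_p.+1) : injectiveb [ffun _ : 'I_1 => j].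
Proof. by apply/injectiveP => x y _; rewrite [x]ord1 [y]ord1. Qed.
(** The vertex [j] of a simplex: pulling back along it contracts every edge except the one labelled
    [j]. *)
Definition pt p (j : 'I_p.+1) : inj 0 p :=
  exist (fun f : {ffun _ -> _} => injectiveb f) _ (pt_subproof j).

Lemma ptE p (j : 'I_p.+1) i : pt j i = j.
Proof. by rewrite /inj_fun /= ffunE. Qed.

Lemma codom_pt p (j k : 'I_p.+1) : (k \in codom (pt j)) = (k == j).
Proof.
apply/codomP/eqP => [[i ->]|->]; first by rewrite ptE.
by exists ord0; rewrite ptE.
Qed.

Lemma inj_comp_pt p q (f : inj p q) (j : 'I_p.+1) : inj_comp f (pt j) = pt (f j).
Proof. by apply: val_inj; apply/ffunP => i; rewrite !ffunE ptE. Qed.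

Section Codes.
Variables (N : nat) (w : 'I_N -> rat) (i0 : 'I_N).

Section OneGraph.
Variables (p : nat) (G : el_graph w p).
Implicit Types (j k : 'I_p.+1) (x y u v : vert G).

Let adjS : symmetric (@adj _ _ G). Proof. by case: (adj_tree G). Qed.
Let adjI : irreflexive (@adj _ _ G). Proof. by case: (adj_tree G). Qed.
Let adjC : forall x y, connect (@adj _ _ G) x y. Proof. by case: (adj_tree G). Qed.

Definition lrel j x y :=
  [exists a : edge G, (val a == [set x; y]) && (lab a == j)].

(** The edges dropped by [pt j] are those with other labels, so this is the tree with edge [j]
    deleted. *)
Definition cut j : rel (vert G) := @dropped N w 0 p (pt j) G.

(** As [j] varies this says on which side of every edge [v] lies; the side of the marking [i0]
    counts as true. *)
Definition code j v := connect (cut j) (mark G i0) v.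

Lemma lrelP j x y :
  reflect (exists2 a : edge G, val a = [set x; y] & lab a = j) (lrel j x y).
Proof.
apply: (iffP existsP) => -[a]; first by case/andP=> /eqP ? /eqP; exists a.
by move=> aE aj; exists a; rewrite aE aj !eqxx.
Qed.

Lemma lrelC j x y : lrel j x y = lrel j y x.
Proof. by rewrite /lrel setUC. Qed.

Lemma adj_lrel x y : reflect (exists j, lrel j x y) (adj x y).
Proof.
apply: (iffP idP) => [xy|[j /lrelP[a aE _]]].
  by have [a aE] := mk_edge xy; exists (lab a); apply/lrelP; exists a.
have [u [v [uv]]] := edge_ends a.
by rewrite aE => /pair_eq[] [-> ->] //; rewrite adjS.
Qed.

Lemma lrel_lab j k x y : lrel j x y -> lrel k x y -> j = k.
Proof.
move=> /lrelP[a aE <-] /lrelP[b bE <-]; congr lab.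
by apply: val_inj; rewrite aE bE.
Qed.

Lemma lrel_ends j x y u v : lrel j x y -> lrel j u v -> [set x; y] = [set u; v].
Proof.
move=> /lrelP[a <- aj] /lrelP[b <- bj]; congr val.
by apply: (bij_inj (lab_bij G)); rewrite aj bj.
Qed.

Lemma lrel_exists j : exists x y, lrel j x y.
Proof.
have [g _ gK] := lab_bij G; have [x [y [_ E]]] := edge_ends (g j).
by exists x, y; apply/lrelP; exists (g j).
Qed.

Lemma cutP j x y : reflect (exists2 k, k != j & lrel k x y) (cut j x y).
Proof.
apply: (iffP existsP) => [[a /andP[/eqP aE]]|[k kj /lrelP[a aE ak]]].
  by rewrite codom_pt => aj; exists (lab a) => //; apply/lrelP; exists a.
by exists a; rewrite aE eqxx codom_pt ak.
Qed.

Lemma cut_sym j : connect_sym (cut j).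
Proof. by apply: sym_connect_sym => x y; rewrite /cut /dropped /= setUC. Qed.

Lemma cut_bridge j x y : lrel j x y -> ~~ connect (cut j) x y.
Proof.
move=> xy; have exy : adj x y by apply/adj_lrel; exists j.
case: (adj_tree G) => _ _ _ _ ac.
apply: contra (acyclic_bridge adjS adjI ac exy); apply: connect_sub => u v.
case/cutP=> k kj uv; apply: connect1; rewrite /del_edge /=; apply/andP; split.
  by apply/adj_lrel; exists k.
apply: contraNneq kj => E; apply/eqP; apply: lrel_lab uv _.
by move: xy; rewrite /lrel -E.
Qed.

Lemma cut_sides j x y v : lrel j x y ->
  connect (cut j) x v || connect (cut j) y v.
Proof.
move=> xy; have /connectP[s sP ->] := adjC x v.
suff gen a : connect (cut j) x a || connect (cut j) y a -> path (@adj _ _ G) a s ->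
    connect (cut j) x (last a s) || connect (cut j) y (last a s).
  by apply: gen sP; rewrite connect0.
elim: s {sP} a => //= b s IH a aP /andP[/adj_lrel[k ab]].
apply: IH; have [kj|kj] := eqVneq k j.
  move: ab; rewrite kj => /lrel_ends/(_ xy) /pair_eq[] [_ ->];
  by rewrite connect0 ?orbT.
have ab' : connect (cut j) a b by apply/connect1/cutP; exists k.
by case/orP: aP => /connect_trans/(_ ab') ->; rewrite ?orbT.
Qed.

(** Deleting one edge leaves exactly two components, so two vertices off the component of [i0] are
    connected to each other. *)
Lemma code_cut j u v : (code j u == code j v) = connect (cut j) u v.
Proof.
have [x [y xy]] := lrel_exists j; pose c a := connect (cut j) x a.
suff cE a b : connect (cut j) a b = (c a == c b).
  by rewrite /code !cE; case: (c u); case: (c v); case: (c (mark G i0)).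
apply/idP/eqP => [ab|]; first exact: same_connect_r (cut_sym j) _ _ ab _.
have trans z : connect (cut j) z a -> connect (cut j) z b -> connect (cut j) a b.
  by rewrite [connect _ z a]cut_sym; apply: connect_trans.
case/orP: (cut_sides a xy); rewrite -/(c a) => za.
  by rewrite za => /esym; apply: trans za.
case/orP: (cut_sides b xy) => zb; last by move=> _; apply: trans za zb.
by rewrite -/(c b) in zb; rewrite zb => /trans; apply.
Qed.

Lemma lrel_code j x y : lrel j x y -> code j x != code j y.
Proof. by rewrite code_cut; apply: cut_bridge. Qed.

Lemma lrel_code_eq j k x y : lrel k x y -> k != j -> code j x = code j y.
Proof. by move=> xy kj; apply/eqP; rewrite code_cut; apply/connect1/cutP; exists k. Qed.

Lemma code_lrel j x y : adj x y -> code j x != code j y -> lrel j x y.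
Proof.
case/adj_lrel=> k xy; have [<-//|kj] := eqVneq k j.
by rewrite (lrel_code_eq xy kj) eqxx.
Qed.

Lemma code_sep x y : x != y -> exists j, code j x != code j y.
Proof.
move=> xy; have /connectP[s0 s0P yE] := adjC x y.
move: yE; case: (shortenP s0P) => -[|z s] /=; first by move=> _ _ _ yx; rewrite yx eqxx in xy.
case/andP=> /adj_lrel[j xz] sP /andP[xs _] _ yE; exists j.
suff <- : code j z = code j y by apply: lrel_code.
apply/eqP; rewrite code_cut yE; apply/connectP; exists s => //.
have : path (fun u v => adj u v && (u != x) && (v != x)) z s.
  elim: s z sP xs {xz yE} => //= b s IH z /andP[zb sP]; rewrite !inE !negb_or.
  case/and3P=> xz xb xs; rewrite zb -!(eq_sym x) xz xb IH //.
  by rewrite inE negb_or xb.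
apply: sub_path => u v /andP[/andP[/adj_lrel[k uv] ux] vx].
apply/cutP; exists k => //; apply: contraNneq ux => kj; rewrite kj in uv.
have := lrel_ends xz uv; move/pair_eq => -[] [] E; first by rewrite E.
by rewrite E eqxx in vx.
Qed.

(* The half of the tree beyond edge k that avoids edge j is connected in the
   complement of edge j. *)
Lemma code_half j k x y u v : k != j -> lrel j u v ->
  code k x = code k y -> code k x != code k u -> code j x = code j y.
Proof.
move=> kj uv /eqP; rewrite code_cut => /connectP[s sP ->] xu.
have uvk : code k u = code k v by apply: lrel_code_eq uv _; rewrite eq_sym.
elim: s x sP xu => //= z s IH x /andP[xz sP] xu.
have xzk : code k x = code k z by apply/eqP; rewrite code_cut connect1.
rewrite -IH -?xzk //; case/cutP: xz => l lk xz; apply: (lrel_code_eq xz).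
apply: contraNneq xu => lj; rewrite lj in xz.
by have := lrel_ends xz uv; move/pair_eq => -[] [-> _]; rewrite ?uvk.
Qed.

(** Sum the stability condition over [R]. The degrees add up to at most [2 * #|R| - 2] from edges
    inside [R], by [forest_count], plus at most [r] from edges leaving [R]. *)
Lemma region_weight (R : {set vert G}) r : R != set0 ->
  (#|[set z : vert G * vert G | [&& z.1 \in R, z.2 \notin R & adj z.1 z.2]]| <= r)%N ->
  (2 - r%:R < weight w [set i | mark G i \in R])%R.
Proof.
move=> R0 br; case: (adj_tree G) => _ _ _ _ ac.
have cnt := forest_count adjS adjI ac R0.
have degE : (\sum_(x in R) #|adj x| =
    \sum_(x in R) \sum_(y in R) adj x y +
    #|[set z : vert G * vert G | [&& z.1 \in R, z.2 \notin R & adj z.1 z.2]]|)%N.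
  have -> : #|[set z : vert G * vert G | [&& z.1 \in R, z.2 \notin R & adj z.1 z.2]]| =
      (\sum_(x in R) \sum_y ((y \notin R) && adj x y))%N.
    rewrite -sum1_card big_mkcond /= pair_big_dep /= [RHS]big_mkcond /=.
    apply: eq_bigr => -[x y] _ /=; rewrite !inE /= andbT.
    by case: (x \in R) => //=; case: (_ && _).
  rewrite -big_split /=; apply: eq_bigr => x xR.
  rewrite -sum1_card big_mkcond /= [X in (X + _)%N]big_mkcond -big_split /=.
  apply: eq_bigr => y _; rewrite -[y \in adj x]/(adj x y).
  by case: (y \in R); case: (adj x y).
have wR : weight w [set i | mark G i \in R] =
    (\sum_(x in R) weight w [set i | mark G i == x])%R.
  rewrite /weight (partition_big (mark G) (mem R)) /=; last by move=> i; rewrite inE.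
  apply: eq_bigr => x xR; apply: eq_bigl => i.
  by rewrite !inE; have [->|_] := eqVneq (mark G i) x; rewrite ?xR ?andbF.
have pos : (0 < \sum_(x in R)
    (#|adj x|%:R - 2 + weight w [set i | mark G i == x] : rat))%R.
  case/set0Pn: R0 => x0 x0R.
  rewrite (bigD1 x0) //= ltr_pwDl ?stableP // sumr_ge0 // => x _.
  by rewrite ltW ?stableP.
move: pos; rewrite big_split /= -wR big_split /= sumrN sumr_const -natr_sum degE.
rewrite -[(2 *+ _)%R]mulr_natl -natrM; move: cnt br.
set s := (\sum_(x in R) _)%N; set b := #|[set _ | _]|; set W := weight _ _.
rewrite mulnC => cnt br; have cnt' : (s%:R + 2 <= (#|R| * 2)%:R :> rat)%R.
  by rewrite -natrD ler_nat.
have br' : (b%:R <= r%:R :> rat)%R by rewrite ler_nat.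
by rewrite natrD; lra.
Qed.

Lemma lrel_boundary l (R : {set vert G}) :
  (#|[set z : vert G * vert G | [&& z.1 \in R, z.2 \notin R & lrel l z.1 z.2]]| <= 1)%N.
Proof.
rewrite leqNgt; apply/negP => /card_gt1P[[x y] [[x' y'] []]].
rewrite !inE /= => /and3P[xR yR xy] /and3P[xR' yR' xy'].
have := lrel_ends xy xy' => /pair_eq[] [xE yE]; first by rewrite xE yE eqxx.
by rewrite -xE xR in yR'.
Qed.

(** The vertices on the side of [x] for both edges form a region with at most two outgoing edges;
    its weight is positive, so it carries a marking. *)
Lemma halves_marked j k x : exists i,
  code j (mark G i) = code j x /\ code k (mark G i) = code k x.
Proof.
pose R := [set v | (code j v == code j x) && (code k v == code k x)].
have R0 : R != set0 by apply/set0Pn; exists x; rewrite inE !eqxx.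
have : (#|[set z : vert G * vert G | [&& z.1 \in R, z.2 \notin R & adj z.1 z.2]]| <= 2)%N.
  apply: leq_trans (leq_add (lrel_boundary j R) (lrel_boundary k R)).
  apply: leq_trans (leq_card_setU _ _); apply/subset_leq_card/subsetP => -[u v].
  rewrite !inE /= => /and3P[/andP[uj uk] vR uv]; rewrite uj uk vR /=.
  move: vR; rewrite negb_and -(eqP uj) -(eqP uk).
  by rewrite ![code _ v == _]eq_sym => /orP[] /(code_lrel uv)->; rewrite ?orbT.
move/(region_weight R0); rewrite subrr.
have [->|/set0Pn[i]] := eqVneq [set i | mark G i \in R] set0.
  by rewrite /weight big_set0 ltxx.
by rewrite !inE => /andP[/eqP ? /eqP ?] _; exists i.
Qed.

Lemma half_weight j b : (1 < weight w [set i | code j (mark G i) == b])%R.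
Proof.
pose R := [set v | code j v == b].
have R0 : R != set0.
  have [x [y xy]] := lrel_exists j; have := lrel_code xy.
  have [xb _|xb xyN] := eqVneq (code j x) b.
    by apply/set0Pn; exists x; rewrite inE xb.
  apply/set0Pn; exists y; rewrite inE; move: xb xyN.
  by case: (code j x); case: (code j y); case: (b).
have : (#|[set z : vert G * vert G | [&& z.1 \in R, z.2 \notin R & adj z.1 z.2]]| <= 1)%N.
  apply: leq_trans (lrel_boundary j R); apply/subset_leq_card/subsetP => -[u v].
  rewrite !inE /= => /and3P[/eqP uj vR uv]; rewrite uj eqxx vR /=.
  by apply: code_lrel; rewrite // uj eq_sym.
move/(region_weight R0); have -> : (2 - 1 = 1 :> rat)%R by lra.
by congr (_ < weight w _)%R; apply/setP => i; rewrite !inE.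
Qed.

(** The Helly property of subtrees: halves that meet pairwise have a common vertex. *)
Lemma code_realize (e : 'I_p.+1 -> bool) :
  (forall j k, exists x, code j x = e j /\ code k x = e k) ->
  exists v, forall j, code j v = e j.
Proof.
move=> eP; pose D v := [set j | code j v != e j].
case: (arg_minnP (P := predT) (fun v => #|D v|) (i0 := mark G i0)) => // v _ vmin.
exists v => j; apply/eqP; apply: contraT => vj; exfalso.
(* [v] has the fewest wrong sides. If [j] is among them, the end [y] of edge [j] on the right side
   gets [j] right and, by [code_half], keeps everything that [v] has right. *)
have [x [y [xy yj]]] : exists x y, lrel j x y /\ code j y = e j.
  have [x [y xy]] := lrel_exists j; have := lrel_code xy.
  have [xj _|xj xyj] := eqVneq (code j x) (e j); first by exists y, x; rewrite lrelC.
  exists x, y; split=> //.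
  by move: xj xyj; case: (code j x); case: (code j y); case: (e j).
have := vmin y isT; rewrite leqNgt => /negP; apply; apply: proper_card.
apply/properP; split; last by exists j; rewrite !inE ?yj ?eqxx.
apply/subsetP => k; rewrite !inE => yk.
apply/eqP => vk.
have kj : k != j by apply: contraNneq yk => ->; rewrite yj.
have [z [zj zk]] := eP j k.
have := @code_half j k v z y x kj; rewrite lrelC vk zk zj => /(_ xy erefl).
by rewrite eq_sym => /(_ yk) E; rewrite E eqxx in vj.
Qed.

(** Recovers the labelled edges from the codes, so that a bijection of vertices preserving codes is
    an isomorphism. *)
Lemma lrelE j x y : lrel j x y <->
  code j x != code j y /\ forall k, k != j -> code k x = code k y.
Proof.
split=> [xy|[xyj xyk]].
  by split=> [|k kj]; [apply: lrel_code|apply: lrel_code_eq xy _; rewrite eq_sym].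
have [u [v [uv uj]]] : exists u v, lrel j u v /\ code j u = code j x.
  have [u [v uv]] := lrel_exists j; have := lrel_code uv.
  have [ux _|ux uvj] := eqVneq (code j u) (code j x); first by exists u, v.
  exists v, u; rewrite lrelC; split=> //.
  by move: ux uvj; case: (code j u); case: (code j v); case: (code j x).
have uvk k : k != j -> code k u = code k v.
  by move=> kj; apply: lrel_code_eq uv _; rewrite eq_sym.
(* If another edge [k] separated [x] from edge [j], then [x] and [y] would both lie beyond [k] and
   so on one side of [j]. *)
have noK k : k != j -> code k x = code k u.
  move=> kj; apply/eqP; apply: contraT => xu; exfalso.
  by have E := code_half kj uv (xyk k kj) xu; rewrite E eqxx in xyj.
have -> : x = u.
  apply/eqP; apply: contraT => /code_sep[k].
  by have [->|kj] := eqVneq k j; [rewrite uj eqxx|rewrite noK // eqxx].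
suff -> : y = v by [].
apply/eqP; apply: contraT => /code_sep[k]; have [->|kj] := eqVneq k j.
  have := lrel_code uv; rewrite uj; move: xyj.
  by case: (code j x); case: (code j y); case: (code j v).
by rewrite -uvk // -noK // xyk // eqxx.
Qed.

(** Computes codes in explicit trees: whether [b] and [code j] agree is constant along edges, hence
    on the whole tree. *)
Lemma code_coloring j (b : vert G -> bool) :
  (forall x y, adj x y -> (b x != b y) = lrel j x y) ->
  forall v, code j v = (b v == b (mark G i0)).
Proof.
move=> bP v; have cl : closed (@adj _ _ G) [pred x | code j x (+) b x].
  move=> x y xy; rewrite !inE.
  have : (code j x != code j y) = (b x != b y).
    rewrite bP //; apply/idP/idP; first exact: code_lrel.
    exact: lrel_code.
  by do 2!case: (code j _); case: (b x); case: (b y).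
have := closed_connect cl (adjC (mark G i0) v); rewrite !inE {1}/code connect0.
by case: (code j v); case: (b v); case: (b _).
Qed.

Lemma code_compat j k :
  compat [set i | code j (mark G i)] [set i | code k (mark G i)].
Proof.
have [->|jk] := eqVneq j k; first by rewrite /compat subxx.
have [u [v uv]] := lrel_exists j; have [a [b ab]] := lrel_exists k.
(* The half beyond [k] away from edge [j] lies on one side of [j]; the codes of [x] decide which of
   the four inclusions results. *)
have [x xu] : exists x, code k x != code k u.
  have := lrel_code ab; have [<-|au _] := eqVneq (code k a) (code k u); last by exists a.
  by exists b; rewrite eq_sym.
have half i : code k (mark G i) = code k x -> code j (mark G i) = code j x.
  move=> E; have kj : k != j by rewrite eq_sym.
  by apply: (code_half kj uv E); rewrite E.
rewrite /compat; case jx : (code j x) half; case kx : (code k x) => half; apply/or4P.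
- by apply: Or42; apply/subsetP => i; rewrite !inE => /half.
- apply: Or44; apply/subsetP => i; rewrite !inE; apply: contraNT.
  by move/negPf/half.
- apply: Or43; apply/subsetP => i; rewrite !inE => ij; apply/negP => /half.
  by rewrite ij.
- apply: Or41; apply/subsetP => i; rewrite !inE => ij; apply: contraT.
  by move/negPf/half; rewrite ij.
Qed.

End OneGraph.
Arguments lrel {p} G j x y.
Arguments cut {p} G j _ _.
Arguments code {p} G j v.

(** * Trees are determined by their sides *)

Definition side p (G : el_graph w p) j : {set 'I_N} := [set i | code G j (mark G i)].

(** Any two entries of the code of a vertex are attained together by a marking, hence also in the
    other tree, where [code_realize] then yields a vertex with the full code. Codes determine
    vertices and edges, so this is an isomorphism. *)
Lemma side_inj p (G H : el_graph w p) : side G =1 side H -> el_iso G H.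
Proof.
move=> GH; have cm j i : code G j (mark G i) = code H j (mark H i).
  by have /setP/(_ i) := GH j; rewrite !inE.
have half (A B : el_graph w p) : (forall j i, code A j (mark A i) = code B j (mark B i)) ->
    exists f : vert A -> vert B, forall v j, code B j (f v) = code A j v.
  move=> AB; suff /choice[f fP] : forall v, exists v', forall j, code B j v' = code A j v.
    by exists f.
  move=> v; apply: code_realize => j k.
  by have [i [<- <-]] := halves_marked j k v; exists (mark B i).
have [f fP] := half _ _ cm; have [g gP] := half H G (fun j i => esym (cm j i)).
have eq_code (A : el_graph w p) (u v : vert A) : (forall j, code A j u = code A j v) -> u = v.
  by move=> uv; apply/eqP; apply: contraT => /code_sep[j]; rewrite uv eqxx.
have fK : cancel f g by move=> v; apply: eq_code => j; rewrite gP fP.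
have gK : cancel g f by move=> v; apply: eq_code => j; rewrite fP gP.
have flrel j x y : lrel H j (f x) (f y) = lrel G j x y.
  apply/idP/idP => /lrelE[xj xk]; apply/lrelE.
    by split=> [|k /xk]; rewrite -?fP // !fP.
  by split=> [|k /xk]; rewrite !fP.
exists f.
  split=> [|x y|i]; first by exists g.
    by apply/adj_lrel/adj_lrel => -[j xy]; exists j; move: xy; rewrite flrel.
  by apply: eq_code => j; rewrite fP cm.
move=> a b ab; have [x [y [xy aE]]] := edge_ends a.
have h : lrel G (lab a) x y by apply/lrelP; exists a.
apply: (@lrel_lab _ H _ _ (f x) (f y)); last by rewrite flrel.
by apply/lrelP; exists b => //; rewrite ab aE imset_pair.
Qed.

(** Expresses a side through the contraction to one edge, so that its naturality follows from the
    composition of contractions. *)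
Lemma side_pt p (G : el_graph w p) j K : contracts (pt j) G K ->
  side G j = [set i | mark K i0 == mark K i].
Proof.
by case=> c cP; apply/setP => i; rewrite !inE !(ctr_mark cP) (ctr_fiber cP).
Qed.

Lemma side_contracts p q (f : inj p q) (G : el_graph w q) H j :
  contracts f G H -> side H j = side G (f j).
Proof.
move=> GH; have HK := contractP (pt j) H.
have := contraction_comp GH HK; rewrite inj_comp_pt => GK.
by rewrite (side_pt HK) (side_pt GK).
Qed.

Lemma side_iso p (G H : el_graph w p) : el_iso G H -> side G =1 side H.
Proof.
move=> GH j; have GK := contractP (pt j) G; have HL := contractP (pt j) H.
have [f [fbij _ fm] _] := contraction_iso GH GK HL.
rewrite (side_pt GK) (side_pt HL); apply/setP => i.
by rewrite !inE !fm (bij_eq fbij).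
Qed.

Definition cside p (x : el_class w p) j := side (generic_quotient.repr x) j.

Lemma cside_pi p (G : el_graph w p) : cside (\pi_(el_class w p) G)%qT =1 side G.
Proof. by move=> j; apply: side_iso; apply/el_classP; rewrite reprK. Qed.

Lemma cside_pull p q (f : inj p q) (x : el_class w q) j :
  cside (class_pull f x) j = cside x (f j).
Proof. by rewrite /class_pull cside_pi (side_contracts _ (contractP _ _)). Qed.

Lemma cside_inj p (x y : el_class w p) : cside x =1 cside y -> x = y.
Proof. by move=> xy; rewrite -[x]reprK -[y]reprK; apply/el_classP/side_inj. Qed.

Lemma cside_base p (x : el_class w p) j : i0 \in cside x j.
Proof. by rewrite inE /code connect0. Qed.

Lemma cside_weight p (x : el_class w p) j : (1 < weight w (cside x j))%R.
Proof.
by have := half_weight (generic_quotient.repr x) j true; congr (_ < weight w _)%R;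
   apply/setP => i; rewrite !inE eqb_id.
Qed.

Lemma cside_weightC p (x : el_class w p) j : (1 < weight w (~: cside x j))%R.
Proof.
by have := half_weight (generic_quotient.repr x) j false; congr (_ < weight w _)%R;
   apply/setP => i; rewrite !inE eqbF_neg.
Qed.

Lemma cside_compat p (x : el_class w p) j k : compat (cside x j) (cside x k).
Proof. exact: code_compat. Qed.

(** * Existence of simplices with given splits *)

(** Paths with one and two edges will realize a single split and a compatible pair. *)
Definition path_adj p (x y : 'I_p.+2) := (x.+1 == y) || (y.+1 == x).

Lemma path_tree p : is_tree (@path_adj p).
Proof.
have sym : symmetric (@path_adj p) by move=> x y; rewrite /path_adj /= orbC.
split=> //.
- by rewrite card_ord.
- by move=> x; rewrite /path_adj /= orbb; apply/negP => /eqP; lia.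
- suff conn0 x : connect (@path_adj p) ord0 x.
    move=> x y; apply: connect_trans (conn0 y).
    by rewrite (sym_connect_sym sym).
  case: x => k; elim: k => [|k IH] kp.
    by rewrite (_ : Ordinal kp = ord0) //; apply: val_inj.
  by apply: connect_trans (IH (ltnW kp)) (connect1 _); rewrite /path_adj /= eqxx.
apply: bridge_acyclic => // x y.
wlog xy : x y / x.+1 = y :> nat.
  move=> wl exy; have := exy; case/orP => /eqP E; first exact: wl.
  have dS : del_edge (@path_adj p) x y =2 del_edge (@path_adj p) y x.
    by move=> u v; rewrite /del_edge /= (setUC [set x]).
  rewrite (eq_connect dS) (sym_connect_sym (e := del_edge _ _ _)) ?wl //.
    by rewrite sym.
  by move=> u v; rewrite /del_edge /= sym setUC.
(* Once the edge from [x] to its successor is deleted, the initial segment ending at [x] is closed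
   under adjacency. *)
move=> _; have cl : closed (del_edge (@path_adj p) x y) [pred v : 'I_p.+2 | v <= x].
  suff step (u v : 'I_p.+2) : u.+1 = v :> nat -> [set u; v] != [set x; y] ->
      (u <= x) = (v <= x).
    move=> u v /andP[/orP[] /eqP uv xyN]; rewrite !inE; first exact: step.
    by apply/esym/step; rewrite // setUC.
  move=> uv; rewrite -uv; have [ux|ux _] := eqVneq (u : nat) x; last by move/eqP: ux; lia.
  have -> : u = x by apply: val_inj.
  have -> : v = y by apply: val_inj; rewrite /= -uv -xy ux.
  by rewrite eqxx.
apply/negP => /(closed_connect cl); rewrite !inE -xy; lia.
Qed.

Lemma path_graph p (mu : 'I_N -> 'I_p.+2) :
  (forall v, 0 < #|@path_adj p v|%:R - 2 + weight w [set i | mu i == v])%R ->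
  exists G : el_graph w p,
    forall j, side G j = [set i | (mu i <= j) == (mu i0 <= j)].
Proof.
move=> st; pose G0 := StableGraph (path_tree p) st.
(* Edge [j] joins the vertices [j] and [j + 1] of the path. *)
pose lo (j : 'I_p.+1) : 'I_p.+2 := widen_ord (leqnSn _) j.
pose hi (j : 'I_p.+1) : 'I_p.+2 := lift ord0 j.
have adj_lohi j : path_adj (lo j) (hi j) by rewrite /path_adj /= eqxx.
have ends (x y : 'I_p.+2) : path_adj x y -> exists j, [set x; y] = [set lo j; hi j].
  wlog xy : x y / x.+1 = y :> nat.
    by move=> wl exy; have := exy; case/orP => /eqP E;
       [apply: wl|rewrite setUC; apply: wl => //; rewrite /path_adj /= E eqxx].
  have xp : x < p.+1 by rewrite -ltnS xy.
  have -> : x = lo (Ordinal xp) by apply: val_inj.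
  have -> : y = hi (Ordinal xp) by apply: val_inj; rewrite /= /bump /= -xy.
  by exists (Ordinal xp).
have /choice[pe peP] j : exists a : edge G0, val a = [set lo j; hi j].
  exact: (@mk_edge _ _ G0 _ _ (adj_lohi j)).
have pe_inj : injective pe.
  move=> j k /(congr1 val); rewrite !peP => /pair_eq[] [/(congr1 val) /= jk /(congr1 val)].
    by move=> _; apply: val_inj.
  by rewrite /= /bump /= in jk *; lia.
have pe_surj a : exists j, pe j = a.
  have [x [y [xy aE]]] := edge_ends a; have [j jE] := ends _ _ xy.
  by exists j; apply: val_inj; rewrite peP aE jE.
have /choice[l lP] := pe_surj.
have lbij : bijective l by exists pe => // j; apply: pe_inj; rewrite lP.
pose G : el_graph w p := ELGraph lbij; exists G => j; apply/setP => i; rewrite !inE.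
apply: (@code_coloring _ G j (fun v : 'I_p.+2 => v <= j)).
suff step (x y : 'I_p.+2) : x.+1 = y :> nat -> ((x <= j) != (y <= j)) = lrel G j x y.
  by move=> x y /orP[] /eqP /step // E; rewrite eq_sym lrelC.
move=> xy; apply/idP/lrelP => [xyj|[a aE aj]].
  have jx : j = x :> nat by move: xyj; rewrite -xy; lia.
  exists (pe j); last by apply: pe_inj; rewrite lP.
  have -> : x = lo j by apply: val_inj.
  by have -> : y = hi j by apply: val_inj; rewrite /= /bump /= -xy jx.
have : val (pe j) = [set x; y] by rewrite -aE -aj lP.
rewrite peP => /pair_eq[] [/(congr1 val) /= jx /(congr1 val)]; rewrite /= /bump /=; lia.
Qed.

Lemma path_deg_gt0 p (v : 'I_p.+2) : 0 < #|path_adj v|.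
Proof.
apply/card_gt0P; case: v => -[|k] kp; last first.
  by exists (Ordinal (ltnW kp)); rewrite unfold_in /path_adj /= eqxx orbT.
by exists (lift ord0 ord0); rewrite unfold_in /path_adj /= /bump.
Qed.

Lemma path_deg_gt1 p (v : 'I_p.+2) : 0 < v < p.+1 -> 1 < #|path_adj v|.
Proof.
case: v => k kp /= /andP[k0 kp']; apply/card_gt1P.
have kp1 : k.-1 < p.+2 by lia.
have kp2 : k.+1 < p.+2 by lia.
exists (Ordinal kp1), (Ordinal kp2); rewrite !unfold_in /path_adj /= eqxx prednK //.
by rewrite eqxx orbT -val_eqE /=; split=> //; lia.
Qed.

(** The side containing [i0] represents the split, in agreement with [cside_base]. *)
Definition orient (C : {set 'I_N}) := if i0 \in C then C else ~: C.

Lemma orientE C : orient C = [set i | (i \in C) == (i0 \in C)].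
Proof.
by rewrite /orient; case: ifP => _; apply/setP => i; rewrite !inE; case: (i \in C).
Qed.

Lemma point_exists (C : {set 'I_N}) : (1 < weight w C)%R -> (1 < weight w (~: C))%R ->
  exists x : el_class w 0, cside x ord0 = orient C.
Proof.
move=> wC wC'; pose mu i : 'I_2 := if i \in C then ord0 else ord_max.
have [|G GP] := @path_graph 0 mu; last first.
  exists (\pi_(el_class w 0) G)%qT; rewrite cside_pi GP orientE.
  by apply/setP => i; rewrite !inE /mu; do 2!case: (_ \in C).
move=> v; have d1 : (1 <= #|path_adj v|%:R :> rat)%R by rewrite ler1n path_deg_gt0.
suff : (1 < weight w [set i | mu i == v])%R by move: d1; lra.
have [->|->] : v = ord0 \/ v = ord_max.
  by case: v {d1} => -[|[|//]] kp; [left|right]; apply: val_inj.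
  have -> // : [set i | mu i == ord0] = C.
  by apply/setP => i; rewrite !inE /mu; case: (i \in C).
have -> // : [set i | mu i == ord_max] = ~: C.
by apply/setP => i; rewrite !inE /mu; case: (i \in C).
Qed.

Hypothesis w_gt0 : forall i, (0 < w i)%R.

(** A path of three vertices marked by [C], [D :\: C] and [~: D]. The middle one has valence 2 and
    is stable because [D :\: C] has positive weight. *)
Lemma chain_exists (C D : {set 'I_N}) :
  C \proper D -> (1 < weight w C)%R -> (1 < weight w (~: D))%R ->
  exists x : el_class w 1, cside x ord0 = orient C /\ cside x ord_max = orient D.
Proof.
case/properP=> CD [k kD kC] wC wD.
pose mu i : 'I_3 := if i \in C then inord 0 else if i \in D then inord 1 else inord 2.
have muE i : mu i = (if i \in C then 0 else if i \in D then 1 else 2) :> nat.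
  by rewrite /mu; case: (i \in C); case: (i \in D); rewrite inordK.
have [|G GP] := @path_graph 1 mu; last first.
  exists (\pi_(el_class w 1) G)%qT; rewrite !cside_pi !GP !orientE.
  split; apply/setP => i; rewrite !inE !muE.
    by do 2!case: (_ \in C); do 2!case: (_ \in D).
  have := subsetP CD i; have := subsetP CD i0.
  by case: (i0 \in C); case: (i \in C); case: (i0 \in D); case: (i \in D) => //= h1 h2;
     solve [by have := h1 isT | by have := h2 isT].
move=> v; have d1 : (1 <= #|path_adj v|%:R :> rat)%R by rewrite ler1n path_deg_gt0.
have wE (v' : nat) (E : {set 'I_N}) : v = v' :> nat ->
    (forall i, (i \in E) = (mu i == v' :> nat)) ->
    [set i | mu i == v] = E.
  by move=> vv EP; apply/setP => i; rewrite inE EP -vv.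
case: (ltngtP v 1) => v1.
- have v0 : v = 0 :> nat by move: v1; case: (v : nat).
  rewrite (wE _ C v0) => [|i]; first by move: d1; lra.
  by rewrite muE; case: (_ \in C); case: (_ \in D).
- have v2 : v = 2 :> nat by have := ltn_ord v; lia.
  rewrite (wE _ (~: D) v2) => [|i]; first by move: d1; lra.
  rewrite inE muE; have := subsetP CD i.
  by case: (_ \in C); case: (_ \in D) => // /(_ isT).
- have d2 : (2 <= #|path_adj v|%:R :> rat)%R by rewrite ler_nat path_deg_gt1 ?v1.
  suff : (0 < weight w [set i | mu i == v])%R by move: d2; lra.
  have kv : k \in [set i | mu i == v].
    by rewrite inE -val_eqE /= muE (negPf kC) kD v1.
  rewrite /weight (bigD1 k) //= ltr_pwDl // sumr_ge0 // => i _.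
  exact: ltW.
Qed.

(** As [i0] lies in both sets they are not disjoint; each of the other three inclusions gives a
    chain, possibly after taking complements. *)
Lemma pair_exists (A B : {set 'I_N}) : i0 \in A -> i0 \in B -> A != B -> compat A B ->
  (1 < weight w A)%R -> (1 < weight w (~: A))%R ->
  (1 < weight w B)%R -> (1 < weight w (~: B))%R ->
  exists x : el_class w 1, cside x ord0 = A /\ cside x ord_max = B.
Proof.
move=> iA iB AB cAB wA wA' wB wB'.
have oA : orient A = A by rewrite /orient iA.
have oB : orient B = B by rewrite /orient iB.
have oA' : orient (~: A) = A by rewrite /orient inE iA setCK.
have oB' : orient (~: B) = B by rewrite /orient inE iB setCK.
case/or4P: cAB => S.
- have := @chain_exists A B; rewrite oA oB; apply=> //.
  by rewrite properEneq AB.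
- have := @chain_exists (~: A) (~: B); rewrite oA' oB' setCK; apply=> //.
  by rewrite properEneq setCS S (inj_eq (@setC_inj _)) AB.
- by have := subsetP S i0 iA; rewrite inE iB.
- have := @chain_exists (~: A) B; rewrite oA' oB; apply=> //.
  by rewrite properEneq S andbT; apply: contraTneq iB => <-; rewrite inE iA.
Qed.

End Codes.

(** * The action of weight-preserving permutations *)

Section Action.
Variables (N : nat) (w : 'I_N -> rat).
Implicit Types s t : 'S_N.

Definition weight_preserving s := forall i, w (s i) = w i.

Lemma weight_preim s (A : {set 'I_N}) : weight_preserving s ->
  weight w [set i | s i \in A] = weight w A.
Proof.
move=> ws; rewrite /weight [RHS](reindex_inj (@perm_inj _ s)) /=.
by apply: eq_big => i; rewrite ?inE.
Qed.

Section OnePerm.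
Variables (s : 'S_N) (ws : weight_preserving s).

Fact act_stable (G : stable_graph w) v :
  (0 < #|@adj _ _ G v|%:R - 2 + weight w [set i | mark G (s i) == v])%R.
Proof.
have := stableP v; congr (_ < _ + _)%R.
by rewrite -[LHS](weight_preim _ ws); congr weight; apply/setP => i; rewrite !inE.
Qed.

(** Only the markings change, by precomposition with [s]; sides are therefore pulled back along [s]
    and reoriented towards [i0], see [cside_act]. *)
Definition act_base (G : stable_graph w) : stable_graph w :=
  @StableGraph N w _ _ (adj_tree G) (fun i => mark G (s i)) (@act_stable G).

Definition act_graph p (G : el_graph w p) : el_graph w p :=
  @ELGraph N w p (act_base G) (@lab _ _ _ G) (lab_bij G).

Lemma act_contracts p q (f : inj p q) (G : el_graph w q) H :
  contracts f G H -> contracts f (act_graph G) (act_graph H).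
Proof.
case=> c [c1 c2 c3 c4 c5]; exists c; split=> //.
by move=> k; apply: c4.
Qed.

Lemma act_iso p (G H : el_graph w p) :
  el_iso G H -> el_iso (act_graph G) (act_graph H).
Proof.
case=> f [f1 f2 f3] fl; exists f => //; split=> // i.
exact: f3.
Qed.

Definition act_class p (x : el_class w p) : el_class w p :=
  (\pi_(el_class w p) (act_graph (generic_quotient.repr x)))%qT.

Lemma act_class_pi p (G : el_graph w p) :
  act_class (\pi_(el_class w p) G)%qT = (\pi_(el_class w p) (act_graph G))%qT.
Proof. by apply/el_classP/act_iso/el_classP; rewrite reprK. Qed.

Lemma act_class_pull p q (f : inj p q) (x : el_class w q) :
  act_class (class_pull f x) = class_pull f (act_class x).
Proof.
by rewrite act_class_pi (class_pullE (act_contracts (contractP f _))).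
Qed.

Definition act_hom : sd_hom (Delta0 w) (Delta0 w) :=
  @SDHom (Delta0 w) (Delta0 w) act_class act_class_pull.

Lemma cside_act i0 p (x : el_class w p) j :
  cside i0 (act_class x) j =
  [set i | (s i \in cside i0 x j) == (s i0 \in cside i0 x j)].
Proof.
rewrite cside_pi; apply/setP => i; rewrite !inE eq_sym code_cut.
by [].
Qed.

End OnePerm.

Lemma act_class1 (h : weight_preserving 1%g) p (x : el_class w p) :
  act_class h x = x.
Proof.
rewrite -[RHS]reprK; apply/el_classP; exists id.
  by split=> //; [exists id|move=> i /=; rewrite perm1].
by move=> a b; rewrite imset_id => /val_inj->.
Qed.

(** A product of permutations applies its left factor first, so precomposing markings gives a
    homomorphism and not an antihomomorphism. *)
Lemma act_classM s t (hs : weight_preserving s) (ht : weight_preserving t)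
    (hst : weight_preserving (s * t)%g) p (x : el_class w p) :
  act_class hst x = act_class hs (act_class ht x).
Proof.
rewrite [act_class ht x]/act_class act_class_pi; apply/el_classP; exists id.
  by split=> //; [exists id|move=> i /=; rewrite permM].
by move=> a b; rewrite imset_id => /val_inj->.
Qed.

Lemma weight_preservingM s t : weight_preserving s -> weight_preserving t ->
  weight_preserving (s * t)%g.
Proof. by move=> hs ht i; rewrite permM ht hs. Qed.

Lemma weight_preservingV s : weight_preserving s -> weight_preserving s^-1%g.
Proof. by move=> hs i; rewrite -[in RHS](permKV s i) hs. Qed.

Lemma act_classK s t (hs : weight_preserving s) (ht : weight_preserving t) :
  (s * t = 1)%g -> forall p (x : el_class w p), act_class hs (act_class ht x) = x.
Proof.
move=> st p x; have hst : weight_preserving (s * t)%g by apply: weight_preservingM.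
rewrite -(act_classM _ _ hst); move: hst; rewrite st => h.
exact: act_class1.
Qed.

Fact act_aut_invK s (hs : weight_preserving s) :
  hom_comp (act_hom (weight_preservingV hs)) (act_hom hs) = hom_id (Delta0 w).
Proof. by apply: sd_hom_eq => p x; apply: act_classK; rewrite mulVg. Qed.

Fact act_aut_homK s (hs : weight_preserving s) :
  hom_comp (act_hom hs) (act_hom (weight_preservingV hs)) = hom_id (Delta0 w).
Proof. by apply: sd_hom_eq => p x; apply: act_classK; rewrite mulgV. Qed.

Definition act_aut s (hs : weight_preserving s) : sd_aut (Delta0 w) :=
  SDAut (act_aut_invK hs) (act_aut_homK hs).

End Action.

(** * From automorphisms to permutations *)

Section InducedSplitMap.
Variables (N : nat) (w : 'I_N -> rat) (i0 : 'I_N) (H : {set 'I_N}).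
Hypothesis w_gt0 : forall i, (0 < w i)%R.
Hypothesis wH : forall A, (1 < weight w A)%R = stable_side H A.
Notation cside := (@cside N w i0).
Notation orient := (orient i0).
Implicit Types A B C : {set 'I_N}.

Lemma cside_split p (x : el_class w p) j : split_side H (cside x j).
Proof. by rewrite /split_side -!wH cside_weight cside_weightC. Qed.

Lemma orient_id A : i0 \in A -> orient A = A.
Proof. by rewrite /orient => ->. Qed.

Lemma orientC A : orient (~: A) = orient A.
Proof. by rewrite /orient inE; case: (i0 \in A) => //=; rewrite setCK. Qed.

Lemma orient_cside p (x : el_class w p) j : orient (cside x j) = cside x j.
Proof. exact/orient_id/cside_base. Qed.

Lemma mem_orient A : i0 \in orient A.
Proof. by rewrite orientE inE eqxx. Qed.

Lemma orient_split A : split_side H (orient A) = split_side H A.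
Proof. by rewrite /orient; case: ifP => // _; rewrite split_sideC. Qed.

Lemma compat_orient A B : compat (orient A) (orient B) = compat A B.
Proof. by rewrite /orient; do 2!case: ifP => _; rewrite ?compatCl ?compatCr. Qed.

Lemma point_inj (x y : el_class w 0) : cside x ord0 = cside y ord0 -> x = y.
Proof. by move=> xy; apply: (@cside_inj _ _ i0) => j; rewrite [j]ord1. Qed.

Variable pnt : {set 'I_N} -> el_class w 0.
Hypothesis pntP : forall C, split_side H C -> cside (pnt C) ord0 = orient C.

Lemma pnt_cside (x : el_class w 0) : pnt (cside x ord0) = x.
Proof. by apply: point_inj; rewrite pntP ?cside_split // orient_cside. Qed.

Lemma pnt_orient A : split_side H A -> pnt (orient A) = pnt A.
Proof.
by move=> sA; apply: point_inj; rewrite !pntP ?orient_split // orient_id ?mem_orient.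
Qed.

(** The action of [h] on 0-simplices, which are splits, lifted to sides so that it commutes with
    complements. *)
Definition split_map (h : sd_hom (Delta0 w) (Delta0 w)) A :=
  if i0 \in A then cside (h 0 (pnt A)) ord0 else ~: cside (h 0 (pnt A)) ord0.

Lemma orient_split_map h A : orient (split_map h A) = cside (h 0 (pnt A)) ord0.
Proof. by rewrite /split_map; case: ifP => _; rewrite ?orientC orient_cside. Qed.

(** Naturality along [pt j]: the action on 0-simplices determines the sides of every image
    simplex. *)
Lemma split_map_cside h p (x : Delta0 w p) j :
  split_map h (cside x j) = cside (h p x) j.
Proof.
rewrite /split_map cside_base.
have -> : pnt (cside x j) = pull (pt j) x.
  apply: point_inj; rewrite pntP ?cside_split // orient_cside /=.
  by rewrite cside_pull ptE.
by rewrite hom_nat /= cside_pull ptE.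
Qed.

Lemma split_map_morphism h : split_morphism H (split_map h).
Proof.
split=> [A sA|A sA|A B sA sB AB].
- by rewrite -orient_split orient_split_map cside_split.
- have E : pnt (~: A) = pnt A.
    by rewrite -pnt_orient ?split_sideC // orientC pnt_orient.
  by rewrite /split_map inE E; case: (i0 \in A) => //=; rewrite setCK.
rewrite -compat_orient !orient_split_map.
have [oAB|oAB] := eqVneq (orient A) (orient B).
  by rewrite -(pnt_orient sA) -(pnt_orient sB) oAB /compat subxx.
(* Two distinct compatible splits span a 1-simplex; its image under [h] has the two image splits,
   which are therefore compatible. *)
have [x [xA xB]] : exists x : el_class w 1,
    cside x ord0 = orient A /\ cside x ord_max = orient B.
  move: (sA) (sB); rewrite -(orient_split A) -(orient_split B) /split_side -!wH.
  move=> /andP[wA wA'] /andP[wB wB'].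
  by apply: pair_exists; rewrite ?mem_orient ?compat_orient.
have ptx j : cside (h 0 (pnt (cside x j))) ord0 = cside (h 1 x) j.
  by rewrite -[RHS]split_map_cside /split_map cside_base.
rewrite -(pnt_orient sA) -(pnt_orient sB) -xA -xB !ptx.
exact: cside_compat.
Qed.

Lemma split_mapK h k : hom_comp k h = hom_id (Delta0 w) ->
  split_inverse H (split_map h) (split_map k).
Proof.
move=> kh A sA.
have E : pnt (split_map h A) = h 0 (pnt A).
  rewrite -pnt_orient ?orient_split_map ?pnt_cside //.
  exact: morph_side (split_map_morphism h) _ sA.
have i0E : (i0 \in split_map h A) = (i0 \in A).
  by rewrite /split_map; case: ifP => _; rewrite ?in_setC cside_base.
rewrite {1}/split_map i0E E.
have -> : k 0 (h 0 (pnt A)) = pnt A.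
  by have := congr1 (fun g : sd_hom (Delta0 w) (Delta0 w) => g 0 (pnt A)) kh.
by rewrite pntP // /orient; case: (i0 \in A) => //; rewrite setCK.
Qed.

End InducedSplitMap.

Lemma delta_aut_perm (N : nat) (w : 'I_N -> rat) (H : {set 'I_N}) :
  (forall i, 0 < w i)%R -> (forall A, (1 < weight w A)%R = stable_side H A) ->
  (1 < #|H|) -> (1 < #|~: H|) -> (4 < N) ->
  forall phi : sd_aut (Delta0 w), exists2 s : 'S_N,
    (forall i, (s i \in H) = (i \in H)) &
    forall hs : weight_preserving w s, phi = act_aut hs.
Proof.
move=> w_gt0 wH H2 L2 N5 phi.
have T5 : 4 < #|{: 'I_N}| by rewrite card_ord.
have i0 : 'I_N by exists 0; lia.
have [h hH] : exists h, h \in H by apply/card_gt0P; apply: ltnW.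
have [l lH] : exists l, l \in ~: H by apply/card_gt0P; apply: ltnW.
have ptE C : split_side H C -> exists x : el_class w 0, cside i0 x ord0 = orient i0 C.
  by rewrite /split_side -!wH => /andP[]; apply: point_exists.
have [x0 _] : exists x : el_class w 0, cside i0 x ord0 = orient i0 [set h; l].
  apply/ptE/cell_split => //; apply/cellP; exists h, l; split=> //.
  by rewrite -in_setC.
have /choice[pnt pntP] C : exists x : el_class w 0,
    split_side H C -> cside i0 x ord0 = orient i0 C.
  have [sC|_] := boolP (split_side H C); last by exists x0.
  by have [x xC] := ptE C sC; exists x.
have sm k := split_map_morphism w_gt0 wH pntP k.
have [s sH sP] := split_rigidity H2 L2 T5 (sm phi) (sm (aut_inv phi))
  (split_mapK w_gt0 wH pntP (aut_invK phi)) (split_mapK w_gt0 wH pntP (aut_homK phi)).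
(* The inverse appears because [act_aut] pulls sides back whereas [s] pushes them forward. *)
exists s^-1%g => [i|hs]; first by rewrite -sH permKV.
apply: sd_aut_eq => p x; apply: (@cside_inj _ _ i0) => j.
rewrite -(split_map_cside wH pntP) /= cside_act.
have -> : [set i | (s^-1%g i \in cside i0 x j) == (s^-1%g i0 \in cside i0 x j)] =
    orient i0 (s @: cside i0 x j).
  have sE i : (s^-1%g i \in cside i0 x j) = (i \in s @: cside i0 x j).
    by rewrite -{2}(permKV s i) mem_imset //; apply: perm_inj.
  by rewrite orientE; apply/setP => i; rewrite [LHS]in_set [RHS]in_set !sE.
have iF : i0 \in split_map i0 pnt phi (cside i0 x j).
  by rewrite (split_map_cside wH pntP) cside_base.
rewrite -(orient_id iF).
by case: (sP _ (cside_split i0 wH x j)) => ->; rewrite ?orientC.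
Qed.

(** * The weights (eps, ..., eps, 1, ..., 1) *)

Lemma bijective_of_inj_surj (S T : Type) (f : S -> T) :
  injective f -> (forall y, exists x, f x = y) -> bijective f.
Proof.
move=> f_inj f_surj; have [g gK] := choice f_surj.
by exists g => // x; apply: f_inj; rewrite gK.
Qed.

Lemma group_iso_sym (G H : groupType) : group_iso G H -> group_iso H G.
Proof.
case=> f [g fK gK] fM; exists g; first by exists f.
by move=> x y; apply: (can_inj fK); rewrite fM !gK.
Qed.

Section EpsOne.
Variables (m n : nat) (eps : rat).
Hypothesis m2 : (2 <= m)%N.
Hypotheses (eps_gt0 : (0 < eps)%R) (eps_le : (eps <= 1 / m%:R)%R).
Let w := @eps_one_weight m n eps.
Implicit Types (A S : {set 'I_(m + n)}) (s t : 'S_(m + n)) (i : 'I_(m + n)).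

Definition heavy : {set 'I_(m + n)} := [set i : 'I_(m + n) | (m <= i)%N].

Lemma heavyE (i : 'I_(m + n)) : (i \in heavy) = ~~ (i < m)%N.
Proof. by rewrite inE leqNgt. Qed.

Lemma card_heavy : #|heavy| = n.
Proof.
have -> : heavy = [set rshift m j | j : 'I_n].
  apply/setP => i; rewrite inE; apply/idP/imsetP => [mi|[j _ ->]]; last exact: leq_addr.
  have ni : (i - m < n)%N by have := ltn_ord i; lia.
  by exists (Ordinal ni) => //; apply: val_inj; rewrite /= subnKC.
by rewrite card_imset ?card_ord //; apply: rshift_inj.
Qed.

Lemma card_light : #|~: heavy| = m.
Proof. by have := cardsC heavy; rewrite card_heavy card_ord; lia. Qed.

Lemma eps_weightE A :
  weight w A = (#|A :&: heavy|%:R + #|A :\: heavy|%:R * eps)%R.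
Proof.
rewrite /weight (bigID [in heavy]) /=; congr (_ + _)%R.
  rewrite -sumr_const; apply: eq_big => i; first by rewrite !inE.
  by rewrite heavyE /w /eps_one_weight => /andP[_ /negPf->].
rewrite mulr_natl -sumr_const; apply: eq_big => i; first by rewrite !inE andbC.
by rewrite heavyE negbK /w /eps_one_weight => /andP[_ ->].
Qed.

(** All light elements together weigh at most [m * eps <= 1], so a weight above 1 requires a heavy
    element, and then any further element suffices. *)
Lemma eps_weight_gt1 A : (1 < weight w A)%R = stable_side heavy A.
Proof.
rewrite eps_weightE /stable_side -card_gt0 -(cardsID heavy A).
have : (#|A :\: heavy| <= m)%N.
  apply: leq_trans (eq_leq card_light).
  by rewrite subset_leq_card // setDE subsetIr.
move: (#|A :&: heavy|) (#|A :\: heavy|) => h l lm.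
have m0 : (0 < m%:R :> rat)%R by rewrite ltr0n; lia.
have l1 : (l%:R * eps <= 1)%R.
  apply: (@le_trans _ _ (m%:R * (1 / m%:R))%R).
    by apply: ler_pM => //; rewrite ?ler0n ?ler_nat // ltW.
  by rewrite mul1r divff // lt0r_neq0.
have l0 : (0 <= l%:R * eps)%R by rewrite mulr_ge0 ?ler0n // ltW.
case: h => [|[|h]]; first by rewrite add0r ltNge l1.
  rewrite add1n ltnS ltrDl /=; case: (posnP l) => [->|lp]; first by rewrite mul0r ltxx.
  by rewrite mulr_gt0 // ltr0n.
have h0 : (0 <= h%:R :> rat)%R by rewrite ler0n.
have -> : (1 < h.+2%:R + l%:R * eps)%R by rewrite !mulrS; lra.
by rewrite !addSn.
Qed.

Lemma eps_weight_gt0 i : (0 < w i)%R.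
Proof. by rewrite /w /eps_one_weight; case: ifP. Qed.

Lemma heavy_weight_preserving s :
  (forall i, (s i \in heavy) = (i \in heavy)) -> weight_preserving w s.
Proof.
move=> sH i; have := sH i; rewrite !heavyE /w /eps_one_weight.
by do 2!case: (_ < m)%N.
Qed.

(** A vertex is light iff it forms a face with another vertex: a pair with a heavy element weighs
    more than 1, and [2 <= m] provides a second light vertex. *)
Lemma AutK_heavy s : (s \in AutK (Kw w)) <-> forall i, (s i \in heavy) = (i \in heavy).
Proof.
have KE S : (S \in Kw w) = ~~ stable_side heavy S.
  by rewrite inE -eps_weight_gt1 -leNgt.
rewrite inE; split=> [/forallP sK i|sH]; last first.
  apply/forallP => S; rewrite !KE /stable_side -!card_gt0.
  have -> : (s @: S) :&: heavy = s @: (S :&: heavy).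
    apply/setP => y; have [x ->] : exists x, y = s x.
      by exists (s^-1%g y); rewrite permKV.
    by rewrite in_setI !(mem_imset _ _ (@perm_inj _ s)) in_setI sH.
  by rewrite !card_imset //; apply: perm_inj.
have pairK (x y : 'I_(m + n)) : x != y ->
    ([set x; y] \in Kw w) = (x \notin heavy) && (y \notin heavy).
  move=> xy; rewrite KE /stable_side cards2 xy andbT negbK setIUl setU_eq0.
  by rewrite !setI_eq0 !disjoints1.
have lightP (x : 'I_(m + n)) :
    (x \notin heavy) <-> exists2 y, x != y & [set x; y] \in Kw w.
  split=> [xH|[y xy]]; last by rewrite pairK // => /andP[].
  have [y yH yx] : exists2 y, y \in ~: heavy & y \notin [set x].
    apply/subsetPn; apply: contraL m2 => /subset_leq_card.
    by rewrite cards1 card_light -ltnNge.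
  have xy : x != y by move: yx; rewrite inE eq_sym.
  by exists y; rewrite // pairK // xH -in_setC.
apply: negb_inj; apply/idP/idP => /lightP[y xy yK]; apply/lightP.
  exists (s^-1%g y); first by apply: contraNneq xy => ->; rewrite permKV.
  by rewrite (eqP (sK _)) imset_pair permKV.
exists (s y); first by rewrite (inj_eq perm_inj).
by rewrite -imset_pair -(eqP (sK _)).
Qed.

Hypotheses (n2 : (2 <= n)%N) (nm5 : (5 <= n + m)%N).

Definition AutK_wp (u : [subg AutK_group (Kw w)]) : weight_preserving w (sgval u) :=
  heavy_weight_preserving ((AutK_heavy _).1 (subgP u)).

(** On the 0-simplex of a cell, equal actions give preimages under [s] and [t] that agree up to
    complement. They have two of at least five elements, so they agree. *)
Lemma act_aut_inj s t (hs : weight_preserving w s) (ht : weight_preserving w t) :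
  (forall i, (s i \in heavy) = (i \in heavy)) ->
  (forall i, (t i \in heavy) = (i \in heavy)) ->
  act_aut hs = act_aut ht -> s = t.
Proof.
move=> sH tH st; have i0 : 'I_(m + n) by exists 0; lia.
have H2 : (1 < #|heavy|)%N by rewrite card_heavy.
have L2 : (1 < #|~: heavy|)%N by rewrite card_light.
have T5 : (4 < #|{: 'I_(m + n)}|)%N by rewrite card_ord addnC.
have key h l : h \in heavy -> l \notin heavy ->
    [set i | s i \in [set h; l]] = [set i | t i \in [set h; l]].
  move=> hH lH; set C := [set h; l].
  have cC : cell heavy C by apply/cellP; exists h, l.
  have := cell_split H2 L2 T5 cC; rewrite /split_side -!eps_weight_gt1.
  case/andP=> wC wC'; have [x xC] := point_exists i0 wC wC'.
  have := congr1 (fun a : sd_aut (Delta0 w) => cside i0 (a 0 x) ord0) st.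
  rewrite /= !cside_act xC orientE.
  have cardE (r : 'S_(m + n)) : #|[set i | r i \in C]| = 2.
    rewrite -[RHS](_ : #|C| = 2); last first.
      by rewrite cards2; case: eqVneq => // hl; rewrite hl (negPf lH) in hH.
    rewrite -(card_imset _ (@perm_inj _ r)); congr #|pred_of_set _|.
    apply/setP => y; rewrite -[y](permKV r) mem_imset ?inE //.
    exact: perm_inj.
  have dichot : forall r : 'S_(m + n),
      [set i | (r i \in [set i' | (i' \in C) == (i0 \in C)]) ==
               (r i0 \in [set i' | (i' \in C) == (i0 \in C)])] =
      orient i0 [set i | r i \in C].
    move=> r; rewrite orientE; apply/setP => i; rewrite !inE.
    by do 3!case: (_ || _).
  rewrite !dichot /orient; case: ifP => _; case: ifP => _ // E.
  - have := cardsC [set i | t i \in C]; rewrite -E !cardE card_ord.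
    by move: nm5; lia.
  - have := cardsC [set i | s i \in C]; rewrite E !cardE card_ord.
    by move: nm5; lia.
  - exact: (@setC_inj _ _ _ E).
have [h0 h0H] : exists h, h \in heavy by apply/card_gt0P; apply: ltnW.
have [l0] : exists l, l \in ~: heavy by apply/card_gt0P; apply: ltnW.
rewrite in_setC => l0H; apply/permP => i.
(* In a cell containing [s i], the element [t i] also lies; having the same heaviness, they are
   equal. *)
have [iH|iH] := boolP (i \in heavy).
  have siH : s i \in heavy by rewrite sH.
  have /setP/(_ i) := key (s i) l0 siH l0H.
  rewrite !inE eqxx /= => /esym/orP[/eqP//|/eqP E].
  by have := tH i; rewrite E iH (negPf l0H).
have siH : s i \notin heavy by rewrite sH.
have /setP/(_ i) := key h0 (s i) h0H siH.
rewrite !inE eqxx orbT /= => /esym/orP[/eqP E|/eqP//].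
by have := tH i; rewrite E h0H (negPf iH).
Qed.

Lemma delta_aut_iso : group_iso (sd_aut (Delta0 w)) [subg AutK_group (Kw w)].
Proof.
apply: group_iso_sym; exists (fun u => act_aut (AutK_wp u)).
  apply: bijective_of_inj_surj => [u v uv|phi].
    apply: val_inj; apply: act_aut_inj uv; apply/AutK_heavy; exact: subgP.
  have [|||s sH sP] := delta_aut_perm eps_weight_gt0 eps_weight_gt1 _ _ _ phi.
  - by rewrite card_heavy.
  - by rewrite card_light.
  - by rewrite addnC.
  have sK : s \in AutK_group (Kw w) by apply/AutK_heavy.
  have hs := heavy_weight_preserving sH; exists (subg _ s).
  apply: sd_aut_eq => p x; rewrite (sP hs) /=.
  by move: (AutK_wp _); rewrite subgK // => hs'; rewrite (Prop_irrelevance hs' hs).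
move=> u v; apply: sd_aut_eq => p x /=.
exact: act_classM.
Qed.

End EpsOne.

(** * Block permutations and the product of symmetric groups *)

Section PermSum.
Variables m n : nat.

Definition perm_sum_fun (s : 'S_m) (t : 'S_n) (i : 'I_(m + n)) : 'I_(m + n) :=
  match split i with inl j => lshift n (s j) | inr k => rshift m (t k) end.

Lemma perm_sum_lshift s t j : perm_sum_fun s t (lshift n j) = lshift n (s j).
Proof. by rewrite /perm_sum_fun (unsplitK (inl j : 'I_m + 'I_n)). Qed.

Lemma perm_sum_rshift s t k : perm_sum_fun s t (rshift m k) = rshift m (t k).
Proof. by rewrite /perm_sum_fun (unsplitK (inr k : 'I_m + 'I_n)). Qed.

Lemma perm_sum_funM s t s' t' i :
  perm_sum_fun s' t' (perm_sum_fun s t i) = perm_sum_fun (s * s')%g (t * t')%g i.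
Proof.
rewrite -[i]splitK; case: (split i) => k /=.
  by rewrite !perm_sum_lshift permM.
by rewrite !perm_sum_rshift permM.
Qed.

Lemma perm_sum_fun1 i : perm_sum_fun 1 1 i = i.
Proof.
rewrite -[i]splitK; case: (split i) => k /=.
  by rewrite perm_sum_lshift perm1.
by rewrite perm_sum_rshift perm1.
Qed.

Lemma perm_sum_fun_inj s t : injective (perm_sum_fun s t).
Proof.
apply: (can_inj (g := perm_sum_fun s^-1 t^-1)) => i.
by rewrite perm_sum_funM !mulgV perm_sum_fun1.
Qed.

Definition perm_sum s t : 'S_(m + n) := perm (@perm_sum_fun_inj s t).

Lemma perm_sum_heavy s t i : (perm_sum s t i \in heavy m n) = (i \in heavy m n).
Proof.
rewrite !heavyE permE -[i]splitK; case: (split i) => k /=.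
  by rewrite perm_sum_lshift /= !ltn_ord.
by rewrite perm_sum_rshift /= -!leqNgt !leq_addr.
Qed.

Lemma perm_sum_inj s t s' t' : perm_sum s t = perm_sum s' t' -> s = s' /\ t = t'.
Proof.
move=> E; split; apply/permP => k.
  by have /permP/(_ (lshift n k)) := E; rewrite !permE !perm_sum_lshift => /lshift_inj.
by have /permP/(_ (rshift m k)) := E; rewrite !permE !perm_sum_rshift => /rshift_inj.
Qed.

Lemma perm_sum_surj (r : 'S_(m + n)) :
  (forall i, (r i \in heavy m n) = (i \in heavy m n)) -> exists s t, r = perm_sum s t.
Proof.
move=> rH.
have /choice[f fP] (j : 'I_m) : exists j', r (lshift n j) = lshift n j'.
  have := rH (lshift n j); rewrite !heavyE /= ltn_ord => /negbFE rj.
  by exists (Ordinal rj); apply: val_inj.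
have /choice[g gP] (k : 'I_n) : exists k', r (rshift m k) = rshift m k'.
  have := rH (rshift m k); rewrite !heavyE -!leqNgt /= leq_addr => rk.
  have rkn : r (rshift m k) - m < n by have := ltn_ord (r (rshift m k)); lia.
  by exists (Ordinal rkn); apply: val_inj; rewrite /= subnKC.
have f_inj : injective f.
  move=> j j' E; apply: (@lshift_inj m n); apply: (@perm_inj _ r).
  by rewrite !fP E.
have g_inj : injective g.
  move=> k k' E; apply: (@rshift_inj m n); apply: (@perm_inj _ r).
  by rewrite !gP E.
exists (perm f_inj), (perm g_inj); apply/permP => i; rewrite permE.
rewrite -[i]splitK; case: (split i) => k /=.
  by rewrite perm_sum_lshift permE fP.
by rewrite perm_sum_rshift permE gP.
Qed.

End PermSum.

Lemma AutK_iso (m n : nat) (eps : rat) : (2 <= m)%N -> (0 < eps)%R ->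
  (eps <= 1 / m%:R)%R ->
  group_iso [subg AutK_group (Kw (@eps_one_weight m n eps))] ('S_m * 'S_n)%type.
Proof.
move=> m2 eps_gt0 eps_le; apply: group_iso_sym.
set K := AutK_group _.
have KP r : (r \in K) <-> forall i, (r i \in heavy m n) = (i \in heavy m n).
  by have := AutK_heavy m2 eps_gt0 eps_le r.
have inK s t : perm_sum s t \in K.
  by apply/KP => i; apply: perm_sum_heavy.
exists (fun u : 'S_m * 'S_n => subg K (perm_sum u.1 u.2)).
  apply: bijective_of_inj_surj => [u v|x].
    move/(congr1 val); rewrite /= !subgK ?inK // => /perm_sum_inj[].
    by case: u v => [s t] [s' t'] /= -> ->.
  have [s [t E]] := perm_sum_surj ((KP _).1 (subgP x)).
  by exists (s, t); apply: val_inj; rewrite /= subgK ?inK.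
move=> u v; apply: val_inj; rewrite /= !subgK ?groupM ?inK //.
by apply/permP => i; rewrite permM !permE perm_sum_funM.
Qed.

Theorem theorem1p2 (m n : nat) (eps : rat)
    (hn : (2 <= n)%N) (hm : (2 <= m)%N) (hnm : (5 <= n + m)%N)
    (eps_gt0 : (0 < eps)%R) (eps_le : (eps <= 1 / m%:R)%R) :
  let w := @eps_one_weight m n eps in
  group_iso (sd_aut (Delta0 w)) [subg AutK_group (Kw w)] /\
  group_iso [subg AutK_group (Kw w)] ('S_m * 'S_n)%type.
Proof. by split; [apply: delta_aut_iso|apply: AutK_iso]. Qed.
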